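(* Let $Y$ be a connected, locally path connected, first countable, Hausdorff topological space and let $S\subset Y$ be a skeletal subset such that $Y\setminus S$ is semi-locally simply connected. Assume that $Y\setminus S$ is semi-locally simply connected in $Y$. Then the universal covering $\widetilde Y^S\to Y$ possibly branched over $S$ is Galoisian. Furthermore, every covering $X\to Y$ possibly branched over $S$ is isomorphic to the quotient of $\widetilde Y^S$ by a subgroup of $\Gamma(\widetilde Y^S/Y)$. Finally, this subgroup is normal if and only if $X\to Y$ is Galoisian.
   Context: All topological spaces are Hausdorff, locally path connected and first countable. A subset $D$ of a space $X$ is locally connected in $X$ if $U\cap D$ is connected for every open connected $U\subset X$. A subset is portly in $X$ if it is open, dense and locally connected in $X$; a subset is skeletal if its complement is portly. A spread $p:X\to Y$ is a continuous map such that the connected components of preimages $p^{-1}(U)$ of open subsets $U\subset Y$ generate the topology of $X$. It is complete if for every $y\in\overline{p(X)}$ and every inclusion-increasing assignment $\chi$ associating to each open connected neighborhood $U$ of $y$ a connected component $\chi(U)$ of $p^{-1}(U)$, one has $\bigcap_U\chi(U)\neq\emptyset$. A completion of a spread $X\to Y$ is a complete spread $X'\to Y$ with an embedding $X\to X'$ over $Y$ whose image is open, dense and locally connected in $X'$; every spread has a completion, unique up to isomorphism. The ordinary locus $\mathrm{Ord}(Y)$ is the set of $y\in Y$ having an open neighborhood $U$ such that each connected component of $p^{-1}(U)$ is mapped homeomorphically onto $U$ by $p$, and $\mathrm{Ord}(X)=p^{-1}(\mathrm{Ord}(Y))$. A branched covering is a complete surjective spread $X\to Y$ with $X,Y$ connected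 and $\mathrm{Ord}(X)$, $\mathrm{Ord}(Y)$ portly in $X$, $Y$. A ''covering possibly branched over $S$'' is a branched covering with $Y\setminus\mathrm{Ord}(Y)\subset S$. Isomorphism of branched coverings of $Y$ means homeomorphism of total spaces commuting with the projections to $Y$. $\Gamma(X/Y)$ denotes the group of homeomorphisms $\varphi$ of $X$ with $p\circ\varphi=p$. A branched covering $p:X\to Y$ is Galoisian if $\Gamma(X/Y)$ acts transitively on the fibers of $p$. A space $Z$ is semi-locally simply connected if every point $z$ has a neighborhood $U$ such that every loop in $U$ based at $z$ is null-homotopic in $Z$. The universal covering $\widetilde Y^S\to Y$ possibly branched over $S$ is the completion of the spread $\widetilde{Y\setminus S}\to Y$, where $\widetilde{Y\setminus S}$ is the universal covering of $Y\setminus S$. For an open subset $U$ of a space $Z$ and $x\in\overline U$, $\Omega(x,x,U)$ is the set of loops $\gamma:[0,1]\to Z$ with $\gamma(0)=\gamma(1)=x$ and $\gamma(]0,1[)\subset U$; two such loops are homotopic in $\Omega(x,x,U)$ if there is a fixed-ends homotopy $H$ between them with $H([0,1]\times]0,1[)\subset U$. A loop $\gamma\in\Omega(x,x,U)$ is almost trivial with respect to $U$ if for every open neighborhood $V$ of $x$ it is homotopic in $\Omega(x,x,U)$ to an element of $\Omega(x,x,V\cap U)$. An open subset $U$ of $Z$ is semi-locally simply connected at $x\in\overline U$ if there is a connected open neighborhood $V$ of $x$ such that every loop in $\Omega(x,x,V\cap U)$ is almost trivial with respect to $U$. $U$ is semi-locally simply connected in $Z$ if it is dense in $Z$ and semi-locally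 simply connected at every point of $Z$. *)

(* Defs.v *)
From HB Require Import structures.
From mathcomp Require Import all_boot all_order all_algebra generic_quotient.
From mathcomp Require Import all_classical all_reals all_analysis.

Set Implicit Arguments.
Unset Strict Implicit.
Unset Printing Implicit Defensive.
Import Order.TTheory GRing.Theory Num.Theory.
Import numFieldNormedType.Exports.

Local Open Scope classical_set_scope.
Local Open Scope ring_scope.

Section spaces.
Variable R : realType.

Local Notation I01 := (`[(0:R), (1:R)]%classic).

(* Paths are total functions on R of which only the values on [0, 1] matter. *)
Definition path_in (X : topologicalType) (A : set X) (x y : X) (g : R -> X) :=
  [/\ {within I01, continuous g}, g 0 = x, g 1 = y
    & forall t, 0 <= t <= 1 -> A (g t)].

Definition path_connected (X : topologicalType) (A : set X) :=
  forall x y, A x -> A y -> exists g, path_in A x y g.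

Definition locally_path_connected (X : topologicalType) :=
  forall (x : X) (U : set X), nbhs x U ->
    exists V, [/\ open V, V x, V `<=` U & path_connected V].

Definition first_countable (X : topologicalType) :=
  forall x : X, exists B : nat -> set X,
    (forall n, nbhs x (B n)) /\
    (forall U, nbhs x U -> exists n, B n `<=` U).

(* The standing assumption on all the topological spaces considered. *)
Definition standing_space (X : topologicalType) :=
  [/\ hausdorff_space X, locally_path_connected X & first_countable X].

(* The loops at x whose restriction to ]0, 1[ stays in U (which need not
   contain x). *)
Definition Omega (X : topologicalType) (x : X) (U : set X) : set (R -> X) :=
  [set g | [/\ {within I01, continuous g}, g 0 = x, g 1 = x
             & forall t, 0 < t < 1 -> U (g t)]].

(* In h (s, t), s is the parameter of the homotopy and t that of the loops. *)
Definition loop_homotopic (X : topologicalType) (x : X) (U : set X)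
    (g0 g1 : R -> X) :=
  exists h : R * R -> X,
    [/\ {within I01 `*` I01, continuous h},
        forall t, 0 <= t <= 1 -> h (0, t) = g0 t,
        forall t, 0 <= t <= 1 -> h (1, t) = g1 t,
        forall s, 0 <= s <= 1 -> h (s, 0) = x /\ h (s, 1) = x
      & forall s t, 0 <= s <= 1 -> 0 < t < 1 -> U (h (s, t))].

Definition null_homotopic (X : topologicalType) (x : X) (g : R -> X) :=
  loop_homotopic x setT g (cst x).

Definition simply_connected (X : topologicalType) :=
  path_connected [set: X] /\
  forall (x : X) (g : R -> X), Omega x setT g -> null_homotopic x g.

Definition semi_locally_simply_connected (X : topologicalType) :=
  forall z : X, exists2 U, nbhs z U &
    forall g, Omega z U g -> null_homotopic z g.

Definition almost_trivial (X : topologicalType) (x : X) (U : set X)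
    (g : R -> X) :=
  forall V, open V -> V x ->
    exists2 g', Omega x (V `&` U) g' & loop_homotopic x U g g'.

Definition semi_locally_simply_connected_at (X : topologicalType)
    (U : set X) (x : X) :=
  exists V, [/\ open V, connected V, V x
    & forall g, Omega x (V `&` U) g -> almost_trivial x U g].

Definition semi_locally_simply_connected_in (X : topologicalType)
    (U : set X) :=
  dense U /\ forall x, semi_locally_simply_connected_at U x.

End spaces.

Section portly.
Variable X : topologicalType.

Definition locally_connected_in (D : set X) :=
  forall U : set X, open U -> connected U -> connected (U `&` D).

Definition portly (D : set X) :=
  [/\ open D, dense D & locally_connected_in D].

Definition skeletal (S : set X) := portly (~` S).

Definition components (A : set X) : set (set X) :=
  [set connected_component A x | x in A].

Definition topology_axioms (G : set (set X)) :=
  [/\ G setT, setI_closed G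
    & forall F : set (set X), F `<=` G -> G (\bigcup_(A in F) A)].

Definition generates_topology (B : set (set X)) :=
  @open X = smallest topology_axioms B.

End portly.

Section maps.
Variables X Y : topologicalType.
Implicit Types f p : X -> Y.

Definition homeomorphism f :=
  exists g : Y -> X, [/\ continuous f, continuous g, cancel f g & cancel g f].

Definition homeomorphism_on f (A : set X) (B : set Y) :=
  exists g : Y -> X,
    [/\ set_fun A B f, set_fun B A g, {in A, cancel f g}, {in B, cancel g f}
      & {within A, continuous f} /\ {within B, continuous g}].

Definition embedding f :=
  injective f /\
  forall A : set X, open A <-> exists2 B : set Y, open B & f @^-1` B = A.

Definition spread p :=
  continuous p /\
  generates_topology
    [set C | exists2 U : set Y, open U & components (p @^-1` U) C].

Definition complete_map p :=
  forall y, closure (range p) y ->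
  forall chi : set Y -> set X,
    let N := [set U : set Y | [/\ open U, connected U & U y]] in
    (forall U, N U -> components (p @^-1` U) (chi U)) ->
    (forall U V, N U -> N V -> U `<=` V -> chi U `<=` chi V) ->
    \bigcap_(U in N) chi U !=set0.

Definition complete_spread p := spread p /\ complete_map p.

Definition Ord_base p : set Y :=
  [set y | exists U : set Y,
     [/\ open U, U y
       & forall C, components (p @^-1` U) C -> homeomorphism_on p C U]].

Definition Ord_total p : set X := p @^-1` Ord_base p.

Definition branched_covering p :=
  [/\ complete_spread p, range p = setT,
      connected [set: X] /\ connected [set: Y],
      portly (Ord_total p) & portly (Ord_base p)].

Definition covering_possibly_branched_over (S : set Y) p :=
  branched_covering p /\ ~` Ord_base p `<=` S.

(* On locally connected spaces the evenly covered neighborhoods can be taken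
   connected, and then the sheets are the components of the preimage. *)
Definition covering p :=
  [/\ continuous p, range p = setT & Ord_base p = setT].

End maps.

(* The embedding i exhibits p' : X' -> Y as a completion of p : X -> Y. *)
Definition is_completion (X X' Y : topologicalType) (p : X -> Y)
    (p' : X' -> Y) (i : X -> X') :=
  [/\ spread p, complete_spread p', embedding i, p' \o i = p
    & portly (range i)].

Definition isomorphic_over (X X' Y : topologicalType) (p : X -> Y)
    (p' : X' -> Y) :=
  exists2 f : X -> X', homeomorphism f & p' \o f = p.

Section universal.
Variable R : realType.

Definition universal_covering (W Z : topologicalType) (c : W -> Z) :=
  covering c /\ simply_connected R W.

(* pt : Yt -> Y is a model of the universal covering possibly branched over S,
   which is determined up to isomorphism over Y. *)
Definition universal_covering_possibly_branched_over (Y : topologicalType)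
    (S : set Y) (Yt : topologicalType) (pt : Yt -> Y) :=
  exists (W : topologicalType) (c : W -> set_type (~` S)) (i : W -> Yt),
    [/\ standing_space R W, universal_covering c
      & is_completion (set_val \o c) pt i].

End universal.

(* The group Gamma(X/Y) of p : X -> Y. *)
Section deck_group.
Variables (X Y : topologicalType) (p : X -> Y).

Record deck := Deck {
  deck_fun :> X -> X;
  deck_inv : X -> X;
  deck_continuous : continuous deck_fun;
  deck_inv_continuous : continuous deck_inv;
  deck_funK : cancel deck_fun deck_inv;
  deck_invK : cancel deck_inv deck_fun;
  deck_over : p \o deck_fun = p }.

HB.instance Definition _ := gen_eqMixin deck.
HB.instance Definition _ := gen_choiceMixin deck.

Lemma deck_eqP (f g : deck) : f = g <-> f =1 g.
Proof.
split=> [->//|]; case: f g => [f f' cf cf' fK Kf pf] [g g' cg cg' gK Kg pg] /=.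
move=> /funext fg; subst g.
have fg' : f' = g' by apply/funext => x; rewrite -[x in LHS]Kg fK.
subst g'; congr Deck; exact: Prop_irrelevance.
Qed.

Lemma deckP (f : X -> X) :
  (exists g : deck, f = g) <-> homeomorphism f /\ p \o f = p.
Proof.
split=> [[[g g' cg cg' gK Kg pg] ->]|[[g [cf cg fK gK]] pf]] /=.
  by split => //; exists g'.
by exists (Deck cf cg fK gK pf).
Qed.

Definition deck_one : deck := @Deck idfun idfun
  (fun x => cvg_id) (fun x => cvg_id) (fun=> erefl) (fun=> erefl) erefl.

Lemma deck_inv_over (f : deck) : p \o deck_inv f = p.
Proof.
by rewrite -{1}(deck_over f) -compA; apply/funext => x /=; rewrite deck_invK.
Qed.

Definition deck_invg (f : deck) : deck :=
  Deck (@deck_inv_continuous f) (@deck_continuous f)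
       (@deck_invK f) (@deck_funK f) (deck_inv_over f).

Lemma continuous_comp_fun (f g : X -> X) :
  continuous f -> continuous g -> continuous (f \o g).
Proof. by move=> cf cg x; apply: continuous_comp; [exact: cg|exact: cf]. Qed.

Lemma deck_comp_over (f g : deck) : p \o (f \o g) = p.
Proof. by rewrite compA !deck_over. Qed.

Definition deck_mul (f g : deck) : deck :=
  @Deck (f \o g) (deck_inv g \o deck_inv f)
    (continuous_comp_fun (@deck_continuous f) (@deck_continuous g))
    (continuous_comp_fun (@deck_inv_continuous g) (@deck_inv_continuous f))
    (can_comp (@deck_funK f) (@deck_funK g))
    (can_comp (@deck_invK g) (@deck_invK f))
    (deck_comp_over f g).

Lemma deck_mulA : associative deck_mul.
Proof. by move=> f g h; apply/deck_eqP. Qed.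
Lemma deck_mul1 : left_id deck_one deck_mul.
Proof. by move=> f; apply/deck_eqP. Qed.
Lemma deck_1mul : right_id deck_one deck_mul.
Proof. by move=> f; apply/deck_eqP. Qed.
Lemma deck_mulV : left_inverse deck_one deck_invg deck_mul.
Proof. by move=> f; apply/deck_eqP => x /=; rewrite deck_funK. Qed.
Lemma deck_Vmul : right_inverse deck_one deck_invg deck_mul.
Proof. by move=> f; apply/deck_eqP => x /=; rewrite deck_invK. Qed.

HB.instance Definition _ := isGroup.Build deck
  deck_mulA deck_mul1 deck_1mul deck_mulV deck_Vmul.

Definition galoisian :=
  branched_covering p /\
  forall x x' : X, p x = p x' -> exists f : deck, f x = x'.

End deck_group.

Definition normal_subgroup (G : groupType) (H : groupClosed G) :=
  forall g h : G, h \in H -> (h ^ g)%g \in H.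

Section orbit_space.
Local Open Scope quotient_scope.
Variables (X Y : topologicalType) (p : X -> Y) (H : groupClosed (deck p)).

Definition orbit_rel : rel X := fun x y => `[< exists2 f, f \in H & f x = y >].

Lemma orbit_rel_refl : reflexive orbit_rel.
Proof. by move=> x; apply/asboolP; exists 1%g => //; exact: gpred1. Qed.

Lemma orbit_rel_sym : symmetric orbit_rel.
Proof.
suff S x y : orbit_rel x y -> orbit_rel y x.
  by move=> x y; apply/idP/idP; exact: S.
move=> /asboolP[f fH <-]; apply/asboolP; exists (f^-1)%g; first exact: gpredVr.
exact: deck_funK.
Qed.

Lemma orbit_rel_trans : transitive orbit_rel.
Proof.
move=> y x z /asboolP[f fH <-] /asboolP[g gH <-]; apply/asboolP.
by exists (g * f)%g => //; exact: gpredM.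
Qed.

Definition orbit_equiv :=
  EquivRel orbit_rel orbit_rel_refl orbit_rel_sym orbit_rel_trans.

Definition orbit_space : topologicalType :=
  quotient_topology {eq_quot orbit_equiv}.

Definition orbit_pi (x : X) : orbit_space := \pi_({eq_quot orbit_equiv}) x.

(* The projection X/H -> Y, well defined by orbit_projE. *)
Definition orbit_proj (z : orbit_space) : Y :=
  p (repr (z : {eq_quot orbit_equiv})).

Lemma orbit_projE (x : X) : orbit_proj (orbit_pi x) = p x.
Proof.
rewrite /orbit_proj /orbit_pi; case: piP => y /eqmodP /asboolP[f _ <-].
exact: (congr1 (fun g => g x) (deck_over f)).
Qed.

End orbit_space.

Arguments orbit_proj {X Y p} H z.

(* Main.v *)
(* Write Y0 = Y \ S. Over Y0 everything is ordinary covering theory: W is simply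
   connected, so W -> Y0 lifts to every X0 = p^-1(Y0) -> Y0, and by completeness
   of X such a lift extends to the completion F : Yt -> X. Semi-local simple
   connectedness of Y0 in Y controls the fibres over S: if every loop of
   Omega(y, y, V n Y0) is almost trivial, then each component of p^-1(V) contains
   exactly one point over y. It exists by completeness. If x and x' are two such
   points, a path from x to x' through X0 projects to a loop at y; deforming it
   into small neighborhoods U of y and lifting the deformation shows that x and
   x' lie in the same component of p^-1(U) for all U, hence are equal. Therefore
   a deck transformation matching points of two components over Y0 also matches
   their points over y, which gives transitivity on the fibres of Yt; the same
   argument shows that F is open and surjective and that its fibres are the
   orbits of {f | F o f = F}. *)
Require Import Defs.
From mathcomp Require Import all_boot all_order all_algebra.
From mathcomp Require Import all_classical all_reals all_analysis.
From mathcomp Require Import lra.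

Set Implicit Arguments.
Unset Strict Implicit.
Unset Printing Implicit Defensive.
Import Order.TTheory GRing.Theory Num.Theory.
Import numFieldNormedType.Exports.
Local Open Scope classical_set_scope.
Local Open Scope ring_scope.

(** The obstacle is that nothing lifts through a point of [S], where there may be no sheets. Two
    devices reach such points. First countability provides, for a point possibly outside a portly
    set, a path that lies in the set at all later times; the path from x to x' of the overview is
    made of two such rays, which is why its projection is a loop of [Omega]. And a homotopy in
    [Omega] can leave Y0 only at its two fixed ends, so it is lifted over the open interval ]0, 1[
    and the ends are controlled by compactness of the time segment. Deck transformations come from
    the lifting property of [pt] applied to [pt] itself, two lifts being equal as soon as they agree
    at one point over Y0. The same rigidity governs normality: a subgroup with quotient X is the
    full group leaving the projection F invariant, and it is normal exactly when every deck
    transformation of [pt] descends to X. *)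

Section general_topology.

Lemma nbhs_openP (T : topologicalType) (x : T) (N : set T) :
  nbhs x N -> exists U, [/\ open U, U x & U `<=` N].
Proof. by rewrite nbhsE => -[U [oU Ux] UN]; exists U. Qed.

Lemma nbhs_open (T : topologicalType) (x : T) (U : set T) :
  open U -> U x -> nbhs x U.
Proof. by move=> oU Ux; apply: open_nbhs_nbhs. Qed.

Lemma open_nbhsP (T : topologicalType) (U : set T) :
  (forall x, U x -> nbhs x U) -> open U.
Proof. by rewrite openE. Qed.

(* Every induction along a connected space (path lifting included) is reduced to
   this: a locally constant property spreads over a connected set. *)
Lemma connected_locally_constant (T : topologicalType) (A Q : set T) :
  connected A ->
  (forall z, A z -> exists2 N, nbhs z N &
     forall a b, A a -> A b -> N a -> N b -> Q a -> Q b) ->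
  forall a b, A a -> A b -> Q a -> Q b.
Proof.
move=> cA locQ a b Aa Ab Qa.
pose good (P N : set T) := open N /\ forall x, A x -> N x -> P x.
have goodU P : open (\bigcup_(N in good P) N).
  by apply: bigcup_open => N [].
have goodP P x : A x -> (\bigcup_(N in good P) N) x -> P x.
  by move=> Ax [N [_ NPP] Nx]; exact: NPP.
have goodQ x : A x -> Q x -> (\bigcup_(N in good Q) N) x.
  move=> Ax Qx; have [N /nbhs_openP[U [oO Ox ON]] NP] := locQ _ Ax.
  exists U => //; split=> // y Ay Oy.
  by apply: (NP x y) => //; exact: ON.
have goodC x : A x -> ~ Q x -> (\bigcup_(N in good (~` Q)) N) x.
  move=> Ax Qx; have [N /nbhs_openP[U [oO Ox ON]] NP] := locQ _ Ax.
  exists U => //; split=> // y Ay Oy Qy.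
  by apply: Qx; apply: (NP y x) => //; exact: ON.
have AQ : A `&` Q = A.
  apply: cA; first by exists a.
  - exists (\bigcup_(N in good Q) N); first exact: goodU.
    apply/seteqP; split=> x [Ax H]; split=> //; [exact: goodQ|exact: goodP].
  - exists (~` \bigcup_(N in good (~` Q)) N).
      exact/open_closedC/goodU.
    apply/seteqP; split=> x [Ax H]; split=> //.
      by move/(goodP _ _ Ax).
    by apply: contrapT => /(goodC _ Ax).
by have [] : (A `&` Q) b by rewrite AQ.
Qed.

Definition locally_connected_space (X : topologicalType) :=
  forall (x : X) (U : set X), nbhs x U ->
    exists V, [/\ open V, V x, V `<=` U & connected V].

Lemma connected_component_open (X : topologicalType) (U : set X) (x : X) :
  locally_connected_space X -> open U -> open (connected_component U x).
Proof.
move=> lcX oU; apply: open_nbhsP => y xy.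
have Uy : U y by exact: connected_component_sub xy.
have [V [oV Vy VU cV]] := lcX _ _ (nbhs_open oU Uy).
apply: filterS (nbhs_open oV Vy) => z Vz.
apply: connected_component_trans xy _.
exact: (connected_component_max Vy VU cV).
Qed.

Lemma connected_component_subset (X : topologicalType) (U V : set X) (x : X) :
  U `<=` V -> connected_component U x `<=` connected_component V x.
Proof.
move=> UV y xy; have Ux : U x.
  by apply: connected_component_sub (connected_component_sym xy).
apply: (connected_component_max _ _ _ xy).
- exact: connected_component_refl.
- by apply: subset_trans UV; exact: connected_component_sub.
- exact: component_connected.
Qed.

Lemma connected_image (S T : topologicalType) (A : set S) (f : S -> T) :
  connected A -> (forall x, A x -> {for x, continuous f}) ->
  connected (f @` A).
Proof.
move=> cA cf; apply: connected_continuous_connected => //.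
by apply: continuous_in_subspaceT => x /set_mem; exact: cf.
Qed.

Lemma hausdorff_separate (X : topologicalType) (x y : X) :
  hausdorff_space X -> x <> y ->
  exists A B, [/\ open A, open B, A x, B y & forall z, A z -> B z -> False].
Proof.
rewrite open_hausdorff => hX /eqP/hX[[A B] /= [/set_mem Ax /set_mem By]].
move=> [oA oB /eqP AB]; exists A, B; split=> // z Az Bz.
by suff : (A `&` B) z by rewrite AB.
Qed.

Lemma eq_of_dense (X Z : topologicalType) (D : set Z) (f g : Z -> X) :
  hausdorff_space X -> continuous f -> continuous g -> dense D ->
  (forall z, D z -> f z = g z) -> f = g.
Proof.
move=> hX cf cg dD fg; apply/funext => z; apply: contrapT => neq.
have [A [B [oA oB Af Bg AB]]] := hausdorff_separate hX neq.
have /nbhs_openP[U [oU Uz UAB]] :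
    nbhs z ((f @^-1` A) `&` (g @^-1` B)).
  by apply: filterI; [apply: cf|apply: cg]; exact: nbhs_open.
have [|w [Uw Dw]] := dD U _ oU; first by exists z.
by have [Afw Bgw] := UAB _ Uw; apply: (AB (f w)) => //; rewrite /= fg.
Qed.

(** A nonempty relatively clopen part [B] has, by density, a nonempty clopen trace on the connected
    intersection of [U] and [D], hence contains all of it. A point left out by [B] would, again by
    density, have a point of [D] left out beside it. This carries portliness from [Y0] to the
    ordinary loci. *)
Lemma portly_sub (X : topologicalType) (D D' : set X) :
  portly D -> open D' -> D `<=` D' -> portly D'.
Proof.
move=> [oD dD lD] oD' DD'; split=> //.
  by move=> U U0 oU; have [x [Ux Dx]] := dD _ U0 oU; exists x; split=> //; exact: DD'.
move=> U oU cU B [b Bb] [C oC BC] [C' cC' BC'].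
have dense_in P : open P -> P `&` U !=set0 -> exists x, [/\ P x, U x & D x].
  move=> oP PU; have [|x [[Px Ux] Dx]] := dD _ PU; first exact: openI.
  by exists x.
have [x [Cx Ux Dx]] : exists x, [/\ C x, U x & D x].
  apply: dense_in => //; exists b.
  by move: Bb; rewrite BC => -[[]].
have UDE : U `&` D `&` C = U `&` D.
  apply: (lD _ oU cU); [by exists x|by exists C|exists C' => //].
  apply/seteqP; split=> z [[Uz Dz] Cz]; split=> //.
    by have : B z by [rewrite BC; split=> //; split=> //; exact: DD']; rewrite BC' => -[].
  by have : B z by [rewrite BC'; split=> //; split=> //; exact: DD']; rewrite BC => -[].
rewrite BC'; apply/setIidPl => z [Uz D'z]; apply: contrapT => C'z.
have [||w [C'w Uw Dw]] := dense_in (~` C'); first exact: closed_openC.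
  by exists z.
have : (U `&` D `&` C) w by rewrite UDE.
case=> _ Cw; apply: C'w.
by have : B w by [rewrite BC; split=> //; split=> //; exact: DD']; rewrite BC' => -[].
Qed.

(** Density makes this connectedness a local matter: where two small neighborhoods overlap, the
    overlap contains a point of [D], so membership in a clopen part passes from one to the other.
    [Q] records that membership at all points of [U], including those outside [D]. *)
Lemma locally_connected_in_local (X : topologicalType) (D U : set X) :
  dense D -> open U -> connected U ->
  (forall x, U x -> exists N, [/\ open N, N x, N `<=` U & connected (N `&` D)]) ->
  connected (U `&` D).
Proof.
move=> dD oU cU locD B [b Bb] [C oC BC] [C' cC' BC'].
have [Ub Db] : (U `&` D) b by rewrite BC in Bb; case: Bb.
pose Q := [set x | exists N, [/\ open N, N x, N `<=` U & N `&` D `<=` B]].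
have QB x : U x -> D x -> Q x -> B x.
  by move=> Ux Dx [N [_ Nx _ NB]]; apply: NB.
have NBP N : open N -> N `<=` U -> connected (N `&` D) ->
    (exists z, [/\ N z, D z & B z]) -> N `&` D `<=` B.
  move=> oN NU cN [z [Nz Dz Bz]].
  have <- : N `&` D `&` C = N `&` D.
    apply: cN; [|by exists C|exists C' => //].
      by exists z; split=> //; move: Bz; rewrite BC => -[].
    apply/seteqP; split=> w [[Nw Dw] Cw]; split=> //.
      by have : B w by [rewrite BC; split=> //; split=> //; exact: NU]; rewrite BC' => -[].
    by have : B w by [rewrite BC'; split=> //; split=> //; exact: NU]; rewrite BC => -[].
  by move=> w [[Nw Dw] Cw]; rewrite BC; split=> //; split=> //; exact: NU.
rewrite BC; apply/setIidPl => x [Ux Dx].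
suff : B x by rewrite BC => -[].
apply: QB => //; apply: (connected_locally_constant cU _ Ub Ux) => [z Uz|].
  have [N [oN Nz NU cN]] := locD _ Uz.
  exists N; first exact: nbhs_open.
  move=> a c Ua Uc Na Nc [M [oM Ma MU MB]]; exists N; split=> //.
  apply: NBP => //.
  have [||w [[Nw Mw] Dw]] := dD (N `&` M); [by exists a|exact: openI|].
  by exists w; split=> //; exact: MB.
have [N [oN Nb NU cN]] := locD _ Ub.
by exists N; split=> //; apply: NBP => //; exists b.
Qed.

Lemma embedding_preimage_connected (W X : topologicalType) (i : W -> X) (A : set X) :
  embedding i -> connected (A `&` range i) -> connected (i @^-1` A).
Proof.
move=> [inji openi] cA B [b Bb] [C oC BC] [C' cC' BC'].
have [G oG GC] := (openi C).1 oC.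
have [G' oG' GC'] := (openi (~` C')).1 (closed_openC cC').
suff E : i @` B = A `&` range i.
  apply/seteqP; split=> x; first by rewrite BC => -[].
  by move=> Ax; have : (i @` B) (i x) by [rewrite E; split]; case=> y By /inji <-.
apply: cA; first by exists (i b), b.
  exists G => //; apply/seteqP; split=> [_ [x + <-]|].
    by rewrite BC -GC => -[Ax Ox]; split=> //; split.
  by move=> y [[Ay [x _ xy]] Gy]; subst y; exists x => //; rewrite BC -GC.
exists (~` G'); first exact: open_closedC.
have C'E : C' = i @^-1` (~` G') by rewrite -preimage_setC GC' setCK.
apply/seteqP; split=> [_ [x + <-]|].
  by rewrite BC' C'E => -[Ax Ox]; split=> //; split.
by move=> y [[Ay [x _ xy]] Gy]; subst y; exists x => //; rewrite BC' C'E.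
Qed.

Lemma embedding_continuous (W X : topologicalType) (i : W -> X) :
  embedding i -> continuous i.
Proof. by move=> [_ oi]; apply/continuousP => A oA; apply/oi; exists A. Qed.

Lemma continuous_pair (S T X : topologicalType) (f : S -> T) (g : S -> X) (x : S) :
  {for x, continuous f} -> {for x, continuous g} ->
  {for x, continuous (fun z => (f z, g z))}.
Proof. by move=> cf cg; exact: cvg_pair cf cg. Qed.

End general_topology.

(** * Gluing along a real parameter and retracting the line onto [0, 1] *)

Section gluing.
Variables (R : realType) (Z X : topologicalType).

(** Each piece has to be continuous at [z] only when [z] lies on its side, boundary included, so a
    local section over a sheet can be glued although it is arbitrary elsewhere. *)
Lemma continuous_at_glue (u : Z -> R) (f g : Z -> X) (b : R) (z : Z) :
  {for z, continuous u} ->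
  (u z <= b -> {for z, continuous f}) -> (b <= u z -> {for z, continuous g}) ->
  (u z = b -> f z = g z) ->
  {for z, continuous (fun z => if u z <= b then f z else g z)}.
Proof.
move=> cu cf cg fg; have [uzb|buz|uzb] := ltgtP (u z) b.
- move=> O; rewrite /= (ltW uzb) => Of.
  have ub : nbhs z (u @^-1` [set x | x < b]).
    by apply: cu; apply: nbhs_open => //; exact: open_lt.
  apply: filterS2 ub (cf (ltW uzb) _ Of) => w /= uwb Ow.
  by rewrite (ltW uwb).
- move=> O; rewrite /= leNgt buz /= => Og.
  have ub : nbhs z (u @^-1` [set x | b < x]).
    by apply: cu; apply: nbhs_open => //; exact: open_gt.
  apply: filterS2 ub (cg (ltW buz) _ Og) => w /= uwb Ow.
  by rewrite leNgt uwb.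
- move=> O; rewrite /= uzb lexx => Of.
  have Og : nbhs (g z) O by rewrite -fg.
  have uz1 : u z <= b by rewrite uzb.
  have uz2 : b <= u z by rewrite uzb.
  have Ofz : nbhs z (f @^-1` O) := cf uz1 _ Of.
  have Ogz : nbhs z (g @^-1` O) := cg uz2 _ Og.
  apply: filterS2 Ofz Ogz => w /= Ofw Ogw.
  by case: ifP.
Qed.

End gluing.

Section clamp.
Variable R : realType.

(* The paths and homotopies of the statement are continuous within [0, 1] only;
   precomposing them with clamp makes them continuous on the whole line. *)
Definition clamp (x : R) : R := if x <= 0 then 0 else if x <= 1 then x else 1.

Lemma clamp_continuous : continuous clamp.
Proof.
move=> x; apply: (@continuous_at_glue _ _ _ id (fun=> 0)
  (fun x => if x <= 1 then x else 1)).
- exact: cvg_id.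
- by move=> _; exact: cst_continuous.
- move=> _; apply: (@continuous_at_glue _ _ _ id id (fun=> 1)).
  + exact: cvg_id.
  + by move=> _; exact: cvg_id.
  + by move=> _; exact: cst_continuous.
  + by [].
- by move=> ->; rewrite ler01.
Qed.

Lemma clamp_ge0 x : 0 <= clamp x.
Proof.
rewrite /clamp; case: (leP x 0) => [//|/ltW x0]; by case: ifP.
Qed.

Lemma clamp_le1 x : clamp x <= 1.
Proof.
by rewrite /clamp; case: ifP => [_|_]; [exact: ler01|case: ifP].
Qed.

Lemma clamp_id x : 0 <= x <= 1 -> clamp x = x.
Proof.
move=> /andP[x0 x1]; rewrite /clamp x1; case: ifP => // xle0.
by apply: le_anti; rewrite x0 xle0.
Qed.

Lemma clamp0 : clamp 0 = 0. Proof. by rewrite /clamp lexx. Qed.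
Lemma clamp1 : clamp 1 = 1. Proof. by rewrite clamp_id ?ler01 ?lexx. Qed.

Lemma clampK x : clamp (clamp x) = clamp x.
Proof. by rewrite clamp_id // clamp_ge0 clamp_le1. Qed.

Lemma clamp_01 x : `[(0:R), 1]%classic (clamp x).
Proof. by rewrite /= in_itv /= clamp_ge0 clamp_le1. Qed.

Lemma within01_clamp (X : topologicalType) (g : R -> X) :
  {within `[(0:R), 1]%classic, continuous g} -> continuous (g \o clamp).
Proof.
move=> /subspace_continuousP cg x O Og.
have /(_ O Og) := cg _ (clamp_01 x); rewrite /within /= => gO.
have cO : nbhs x (clamp @^-1` _) := clamp_continuous gO.
apply: filterS cO => y /=; apply; exact: clamp_01.
Qed.

Lemma within01_clamp2 (X : topologicalType) (h : R * R -> X) :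
  {within `[(0:R), 1]%classic `*` `[(0:R), 1]%classic, continuous h} ->
  continuous (fun z => h (clamp z.1, clamp z.2)).
Proof.
move=> /subspace_continuousP ch z O Oh.
have /(_ O Oh) := ch (clamp z.1, clamp z.2) (conj (clamp_01 _) (clamp_01 _)).
rewrite /within /= => gO.
have c2 : {for z, continuous (fun w : R * R => (clamp w.1, clamp w.2))}.
  apply: continuous_pair.
    by apply: continuous_comp; [exact: cvg_fst|exact: clamp_continuous].
  by apply: continuous_comp; [exact: cvg_snd|exact: clamp_continuous].
have cO : nbhs z ((fun w => (clamp w.1, clamp w.2)) @^-1` _) := c2 _ gO.
apply: filterS cO => y /=; apply; split; exact: clamp_01.
Qed.

Lemma real_connectedT : connected [set: R].
Proof. by apply/connected_intervalP => x y z. Qed.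

End clamp.

Arguments clamp {R} x.

(** * Sheets over ordinary points and uniqueness of lifts *)

Section sheets.
Variables X Y : topologicalType.
Variable p : X -> Y.
Hypothesis lcX : locally_connected_space X.
Hypothesis cp : continuous p.

Lemma within_open_continuous (S T : topologicalType) (A : set S) (f : S -> T)
    (x : S) :
  open A -> A x -> {within A, continuous f} -> {for x, continuous f}.
Proof.
move=> oA Ax /subspace_continuousP cf G Gf.
have /(_ G Gf) := cf _ Ax; rewrite /within /= => wG.
have wG' : nbhs x (fun z => A z -> (f @^-1` G) z) := wG.
by apply: filterS2 wG' (nbhs_open oA Ax) => z; apply.
Qed.

(** The working form of even covering: since [U] and the component [C] are open, the section [g] is
    a total function continuous at the points of [U], without reference to subspaces. *)
Lemma Ord_base_sheet (b : Y) : Ord_base p b ->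
  exists U, [/\ open U, U b & forall x, U (p x) -> exists C g,
    [/\ open C, C x, C `<=` p @^-1` U,
        forall y, U y -> [/\ C (g y), p (g y) = y & {for y, continuous g}]
      & forall x', C x' -> g (p x') = x'] ].
Proof.
move=> [U [oU Ub homU]]; exists U; split=> // x Ux.
have oV : open (p @^-1` U) by move/continuousP : cp; apply.
have [|g [pC gU gp pg [_ cg]]] := homU (connected_component (p @^-1` U) x).
  by exists x.
exists (connected_component (p @^-1` U) x), g; split.
- exact: connected_component_open.
- exact: connected_component_refl.
- exact: connected_component_sub.
- move=> y Uy; split; [exact: gU|by apply: pg; exact: mem_set|].
  exact: within_open_continuous cg.
- by move=> x' Cx'; apply: gp; exact: mem_set.
Qed.

(** Coincidence is locally constant: equal values lie in a common sheet, where [p] is injective, and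
    distinct values have disjoint neighborhoods. The set [D] will be an interval of times or the
    part of a total space over [Y0]. *)
Lemma lift_unique (Z : topologicalType) (D : set Z) (f g : Z -> X) (a : Z) :
  hausdorff_space X -> connected D ->
  (forall z, D z -> {for z, continuous f}) ->
  (forall z, D z -> {for z, continuous g}) ->
  (forall z, D z -> p (f z) = p (g z)) ->
  (forall z, D z -> Ord_base p (p (f z))) ->
  D a -> f a = g a -> forall z, D z -> f z = g z.
Proof.
move=> hX cD cf cg pfg Of Da fga z Dz.
apply: (connected_locally_constant (Q := [set z | f z = g z]) cD _ Da Dz fga).
move=> {z Dz} z Dz; have [fgz|neq] := pselect (f z = g z); last first.
  have [A [B [oA oB Af Bg AB]]] := hausdorff_separate hX neq.
  exists ((f @^-1` A) `&` (g @^-1` B)).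
    by apply: filterI; [apply: cf|apply: cg] => //; exact: nbhs_open.
  by move=> x y _ _ [Afx Bgx] _ fgx; exfalso; apply: (AB (f x)) => //; rewrite fgx.
have [U [oU Ub /(_ (f z) Ub)[C [s [oC Cx _ _ sp]]]]] := Ord_base_sheet (Of _ Dz).
exists ((f @^-1` C) `&` (g @^-1` C)).
  by apply: filterI; [apply: cf|apply: cg] => //; apply: nbhs_open; rewrite -?fgz.
move=> x y _ Dy _ [Cfy Cgy] _ /=.
by rewrite -[LHS]sp// -[RHS]sp// pfg.
Qed.

End sheets.

Lemma ball_interval (R : realType) (c e m s b : R) :
  ball c e m -> ball c e b -> m <= s -> s <= b -> ball c e s.
Proof.
rewrite -!ball_normE /= !ltr_norml => /andP[_ cm] /andP[cb _] ms sb.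
by apply/andP; split; lra.
Qed.

(** * Lifting of paths and homotopies *)

Section homotopy_lifting.
Variables (R : realType) (X Y : topologicalType) (p : X -> Y).
Hypothesis lcX : locally_connected_space X.
Hypothesis hX : hausdorff_space X.
Hypothesis cp : continuous p.

Lemma slice_continuous (S T Z : topologicalType) (f : S * T -> Z) s t :
  {for (s, t), continuous f} ->
  {for s, continuous (fun x => f (x, t))} /\ {for t, continuous (fun x => f (s, x))}.
Proof.
move=> cf; split.
- apply: (@continuous_comp _ _ _ (fun x : S => (x, t)) f); last exact: cf.
  by apply: cvg_pair; [exact: cvg_id|exact: cvg_cst].
- apply: (@continuous_comp _ _ _ (fun x : T => (s, x)) f); last exact: cf.
  by apply: cvg_pair; [exact: cvg_cst|exact: cvg_id].
Qed.

(* A partial lift up to time b is a lift of the homotopy frozen at time b, which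
   spares restrictions to [0, b]. *)
Let cap (b s : R) := if s <= b then s else b.

Let cap_continuous b : continuous (cap b).
Proof.
move=> x; apply: (@continuous_at_glue _ _ _ id id (fun=> b)).
- exact: cvg_id.
- by move=> _; exact: cvg_id.
- by move=> _; exact: cst_continuous.
- by [].
Qed.

Variables (T : topologicalType) (D : set T) (h : R * T -> Y) (f : T -> X).
Hypothesis oD : open D.
Hypothesis ch : forall (s : R) (t : T), D t -> {for (s, t), continuous h}.
Hypothesis h_clamp : forall s t, D t -> h (clamp s, t) = h (s, t).
Hypothesis Oh : forall s t, D t -> Ord_base p (h (s, t)).
Hypothesis cf : forall t, D t -> {for t, continuous f}.
Hypothesis pf : forall t, D t -> p (f t) = h (0, t).

(** All slices near [t0] are lifted at once, so an extension step may shrink the neighborhood of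
    [t0] and only the time is left for the induction. *)
Let partial_lift (t0 : T) (b : R) := exists k : R * T -> X, \forall t \near t0,
  k (0, t) = f t /\
  forall s : R, {for (s, t), continuous k} /\ p (k (s, t)) = h (cap b s, t).

Let partial_lift0 t0 : D t0 -> partial_lift t0 0.
Proof.
move=> Dt0; exists (f \o snd); apply: filterS (nbhs_open oD Dt0) => t Dt.
split=> // s; split.
  by apply: continuous_comp; [exact: cvg_snd|exact: cf].
rewrite /= pf // -(h_clamp (cap 0 s)) // -(h_clamp 0) //; congr (h (_, _)).
by rewrite /cap clamp0 /clamp; case: (leP s 0) => [s0|_] /=; rewrite ?s0 ?lexx.
Qed.

Let partial_liftS (t0 : T) (b0 : R) : D t0 -> exists2 N, nbhs b0 N &
  forall b b' : R, 0 <= b -> 0 <= b' -> N b -> N b' ->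
    partial_lift t0 b -> partial_lift t0 b'.
Proof.
move=> Dt0; have [U [oU Ub sheetU]] := Ord_base_sheet lcX cp (Oh b0 Dt0).
have : nbhs (b0, t0) (h @^-1` U) by apply: ch => //; exact: nbhs_open.
move=> [[A B] /= [/nbhs_ballP[e /= e0 eA] nB] ABU].
have hU s t : ball b0 e s -> B t -> U (h (s, t)).
  by move=> /eA As Bt; apply: (ABU (s, t)).
have Bt0 := nbhs_singleton nB.
exists (ball b0 e); first exact: nbhsx_ballx.
move=> b b' b_ge0 b'_ge0 Nb Nb' [k kP].
(* [m] is the smaller of [b] and [b'], because the property has to propagate in both directions. The
   old lift is kept up to time [m]; afterwards the new one follows the sheet through [k (m, t0)]. *)
have [m [m0 mb mb' Nm]] : exists m, [/\ 0 <= m, m <= b, m <= b' & ball b0 e m].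
  have [bb'|b'b] := leP b b'; first by exists b.
  by exists b'; split=> //; exact: ltW.
have [_ kt0] := nbhs_singleton kP.
have kmt0 : p (k (m, t0)) = h (m, t0) by have [_ ->] := kt0 m; rewrite /cap mb.
have [|C [g [oC Cx CU gU gp]]] := sheetU (k (m, t0)).
  by rewrite kmt0; exact: hU.
have nC : nbhs t0 (fun t => C (k (m, t))).
  have [ckm _] := kt0 m; have [_ ckm2] := slice_continuous ckm.
  by apply: ckm2; exact: nbhs_open.
exists (fun z => if z.1 <= m then k z else g (h (cap b' z.1, z.2))).
near=> t.
have Dt : D t by near: t; exact: nbhs_open.
have Bt : B t by near: t.
have Ct : C (k (m, t)) by near: t.
have [kt pkt] : k (0, t) = f t /\
  forall s : R, {for (s, t), continuous k} /\ p (k (s, t)) = h (cap b s, t).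
  by near: t.
have capU s : m <= s -> U (h (cap b' s, t)).
  move=> ms; apply: hU => //; apply: ball_interval Nm Nb' _ _; rewrite /cap.
    by case: ifP.
  by case: (leP s b') => // ?; rewrite lexx.
split=> /=; first by rewrite m0.
move=> s; have [ck pk] := pkt s; split; last first.
  case: leP => sm; last by have [] := gU _ (capU _ (ltW sm)).
  by rewrite pk /cap !(le_trans sm).
apply: (@continuous_at_glue _ _ _ fst k (fun z => g (h (cap b' z.1, z.2)))).
- exact: cvg_fst.
- by move=> _.
- move=> ms; have [_ _ cg] := gU _ (capU _ ms).
  have chz := ch (s := cap b' s) Dt.
  have cz : {for (s, t), continuous (fun z : R * T => (cap b' z.1, z.2))}.
    apply: continuous_pair; last exact: cvg_snd.
    by apply: continuous_comp; [exact: cvg_fst|exact: cap_continuous].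
  exact: (continuous_comp (continuous_comp cz chz) cg).
- move=> /= sm; rewrite sm; have [_ pkm] := pkt m.
  by rewrite -[LHS]gp // pkm /cap mb mb'.
Unshelve. all: by end_near.
Qed.

Let partial_lift1 t0 : D t0 -> partial_lift t0 1.
Proof.
move=> Dt0.
apply: (connected_locally_constant (A := `[(0:R), 1]%classic)
  (Q := partial_lift t0) _ _ _ _ (partial_lift0 Dt0)).
- exact: segment_connected.
- move=> b _; have [N nN NP] := partial_liftS b Dt0; exists N => //.
  move=> a c; rewrite /= !in_itv /= => /andP[a0 _] /andP[c0 _] Na Nc.
  exact: NP.
- by rewrite /= in_itv /= lexx ler01.
- by rewrite /= in_itv /= lexx ler01.
Qed.

(** Local lifts around different parameters lift the same slice paths from the same points [f t],
    hence agree on common slices by [lift_unique]; the diagonal choice [K z.2 z] is therefore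
    locally a single one of them. The parameters range over an open set [D] so that a homotopy can
    be lifted just where it avoids branch points. *)
Lemma homotopy_lift : exists k : R * T -> X,
  forall t, D t -> k (0, t) = f t /\
    forall s : R, {for (s, t), continuous k} /\ p (k (s, t)) = h (s, t).
Proof.
have cap1 s t : D t -> h (cap 1 s, t) = h (s, t).
  move=> Dt; rewrite -(h_clamp (cap 1 s)) // -(h_clamp s) //; congr (h (_, _)).
  by rewrite /cap; case: ifP => // s1; rewrite clamp1 /clamp s1; case: ifP => // ?; lra.
have /choice[K KP] : forall t, exists k : R * T -> X, D t -> \forall t' \near t,
  k (0, t') = f t' /\
  forall s : R, {for (s, t'), continuous k} /\ p (k (s, t')) = h (s, t').
  move=> t; have [Dt|nDt] := pselect (D t); last first.
    have [[x]|nX] := pselect (exists x : X, True); first by exists (fun=> x).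
    by exists (fun z => f z.2).
  have [k kP] := partial_lift1 Dt; exists k => _.
  apply: filterS2 kP (nbhs_open oD Dt) => t' [k0 kP] Dt'; split=> // s.
  by have [ck ->] := kP s; rewrite cap1.
exists (fun z => K z.2 z) => t Dt.
have [Kt0 KtP] := nbhs_singleton (KP t Dt).
split=> //= s; have [cKs pKs] := KtP s; split=> //.
have near_eq : \forall t' \near t, forall s, K t' (s, t') = K t (s, t').
  apply: filterS2 (KP t Dt) (nbhs_open oD Dt) => t' [K0 Kt'] Dt' s'.
  have [K0' Kt''] := nbhs_singleton (KP t' Dt').
  apply: (lift_unique lcX cp (D := setT) (a := 0) (f := fun s => K t' (s, t'))
    (g := fun s => K t (s, t')) hX) => //.
  - exact: real_connectedT.
  - by move=> z _; apply: (slice_continuous (Kt'' z).1).1.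
  - by move=> z _; apply: (slice_continuous (Kt' z).1).1.
  - by move=> z _; rewrite (Kt'' z).2 (Kt' z).2.
  - by move=> z _; rewrite (Kt'' z).2; exact: Oh.
  - by rewrite K0 K0'.
move=> G /= KG; have cG : nbhs (s, t) (K t @^-1` G) := cKs _ KG.
have sG : nbhs (s, t) (snd @^-1` [set t' | forall s, K t' (s, t') = K t (s, t')]).
  by apply: cvg_snd.
by apply: filterS2 cG sG => -[s' t'] /= Gs ->.
Qed.

End homotopy_lifting.

Lemma path_lift (R : realType) (X Y : topologicalType) (p : X -> Y)
    (g : R -> Y) (x : X) :
  locally_connected_space X -> hausdorff_space X -> continuous p ->
  continuous g -> (forall s, Ord_base p (g s)) -> p x = g 0 ->
  exists k : R -> X, [/\ continuous k, k 0 = x & forall s, p (k s) = g (clamp s)].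
Proof.
move=> lcX hX cp cg Og pg.
have [||||||k kP0] := @homotopy_lift R X Y p lcX hX cp R setT
    (fun z => g (clamp z.1)) (fun=> x).
- exact: openT.
- move=> s t _.
  have cs : {for (s, t), continuous (@clamp R \o fst : R * R -> R)}.
    by apply: continuous_comp; [exact: cvg_fst|exact: clamp_continuous].
  exact: (continuous_comp cs (cg _)).
- by move=> s t _ /=; rewrite clampK.
- by move=> s t _; exact: Og.
- by move=> t _; exact: cst_continuous.
- by move=> t _ /=; rewrite clamp0.
have [k0 kP] := kP0 0 I.
exists (fun s => k (s, 0)); split=> // s; last by have [_ ->] := kP s.
by have [/slice_continuous[]] := kP s.
Qed.

(** * Paths, infinite concatenations and rays into portly sets *)

Section paths.
Variables (R : realType).

(** Continuity and membership are required on the whole line, which removes every restriction to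
    [0, 1]; [joined_path_in] converts from [path_in] by [clamp]. *)
Definition joined (X : topologicalType) (A : set X) (a b : X) :=
  exists g : R -> X, [/\ continuous g, g 0 = a, g 1 = b & forall t, A (g t)].

Lemma concat_rev (X : topologicalType) (f g : R -> X) :
  continuous f -> continuous g -> f 1 = g 1 ->
  exists l : R -> X, [/\ continuous l,
    forall t, t <= 2^-1 -> l t = f (2 * t)
  & forall t, 2^-1 <= t -> l t = g (2 - 2 * t)].
Proof.
move=> cf cg fg1; pose l t := if t <= 2^-1 then f (2 * t) else g (2 - 2 * t).
have lg t : 2^-1 <= t -> l t = g (2 - 2 * t).
  rewrite /l; case: (ltgtP t 2^-1) => // -> _.
  have -> : 2 - 2 * 2^-1 = 1 :> R by lra.
  by rewrite divff ?pnatr_eq0.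
exists l; split=> //; last by move=> t t2; rewrite /l t2.
move=> t; apply: (@continuous_at_glue _ _ _ id (fun u => f (2 * u))
  (fun u => g (2 - 2 * u))).
- exact: cvg_id.
- move=> _; have c2 : {for t, continuous (fun u : R => 2 * u)}.
    exact: mulrl_continuous.
  exact: (continuous_comp c2 (cf _)).
- move=> _; have c2 : {for t, continuous (fun u : R => 2 - 2 * u)}.
    apply: (@continuousB R R R (fun=> 2) (fun u : R => 2 * u)).
      exact: cst_continuous.
    exact: mulrl_continuous.
  exact: (continuous_comp c2 (cg _)).
- by move=> /= t2; have := lg t; rewrite /l t2 lexx; apply.
Qed.

Lemma joined_trans (X : topologicalType) (A : set X) (a b c : X) :
  joined A a b -> joined A b c -> joined A a c.
Proof.
move=> [f [cf f0 f1 Af]] [g [cg g0 g1 Ag]].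
exists (fun u => if u <= 2^-1 then f (2 * u) else g (2 * u - 1)); split.
- move=> x; apply: (@continuous_at_glue _ _ _ id (fun u => f (2 * u))
    (fun u => g (2 * u - 1))).
  + exact: cvg_id.
  + move=> _; have c2 : {for x, continuous (fun u : R => 2 * u)}.
      exact: mulrl_continuous.
    exact: (continuous_comp c2 (cf _)).
  + move=> _; have c2 : {for x, continuous (fun u : R => 2 * u - 1)}.
      apply: (@continuousB _ _ _ (fun u : R => 2 * u) (fun=> 1)).
        exact: mulrl_continuous.
      exact: cst_continuous.
    exact: (continuous_comp c2 (cg _)).
  + by move=> /= ->; rewrite divff ?pnatr_eq0 // f1 subrr g0.
- by rewrite invr_ge0 ler0n mulr0.
- have /negbTE -> : ~~ (1 <= 2^-1 :> R) by rewrite -ltNge; lra.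
  by rewrite mulr1 -g1; congr g; lra.
- by move=> t; case: ifP.
Qed.

Lemma joined_sub (X : topologicalType) (A B : set X) (a b : X) :
  A `<=` B -> joined A a b -> joined B a b.
Proof. by move=> AB [g [cg g0 g1 Ag]]; exists g; split=> // t; exact: AB. Qed.

Lemma joined_path_in (X : topologicalType) (A : set X) (a b : X) (g : R -> X) :
  path_in A a b g -> joined A a b.
Proof.
move=> [cg g0 g1 Ag]; exists (g \o clamp); split => /=.
- exact: within01_clamp.
- by rewrite clamp0.
- by rewrite clamp1.
- by move=> t; apply: Ag; rewrite clamp_ge0 clamp_le1.
Qed.

Lemma joined_image (X Y : topologicalType) (A : set X) (B : set Y) (f : X -> Y)
    (a b : X) :
  (forall x, A x -> {for x, continuous f} /\ B (f x)) ->
  joined A a b -> joined B (f a) (f b).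
Proof.
move=> fAB [g [cg g0 g1 Ag]]; exists (f \o g); split => /=.
- by move=> t; exact: (continuous_comp (cg t) (fAB _ (Ag t)).1).
- by rewrite g0.
- by rewrite g1.
- by move=> t; exact: (fAB _ (Ag t)).2.
Qed.

Lemma joined_component (X : topologicalType) (A : set X) (a b : X) :
  joined A a b -> connected_component A a b.
Proof.
move=> [g [cg g0 g1 Ag]]; exists (range g); last by exists 1.
split; [by exists 0|by move=> _ [t _ <-]|].
by apply: connected_image; [exact: real_connectedT|move=> ? _; exact: cg].
Qed.

Lemma path_connected_connected (X : topologicalType) (A : set X) :
  path_connected R A -> connected A.
Proof.
move=> pA; have [->|/set0P[a Aa]] := eqVneq A set0; first exact: connected0.
suff <- : connected_component A a = A by exact: component_connected.
apply/seteqP; split; first exact: connected_component_sub.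
by move=> b Ab; have [g /joined_path_in] := pA _ _ Aa Ab; exact: joined_component.
Qed.

Lemma lpc_locally_connected (X : topologicalType) :
  locally_path_connected R X -> locally_connected_space X.
Proof.
move=> lpX x U /lpX[V [oV Vx VU pV]]; exists V; split=> //.
exact: path_connected_connected.
Qed.

Lemma open_connected_joined (X : topologicalType) (A : set X) (a b : X) :
  locally_path_connected R X -> open A -> connected A -> A a -> A b ->
  joined A a b.
Proof.
move=> lpX oA cA Aa Ab.
apply: (connected_locally_constant (Q := joined A a) cA _ Aa Ab).
  move=> z Az; have [V [oV Vz VA pV]] := lpX _ _ (nbhs_open oA Az).
  exists V; first exact: nbhs_open.
  move=> x y _ _ Vx Vy ax; apply: (joined_trans ax).
  by have [g /joined_path_in] := pV _ _ Vx Vy; exact: joined_sub.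
by exists (fun=> a); split=> // ?; exact: cst_continuous.
Qed.

(** Every use of first countability passes through this sequence. Starting it at [A] keeps the rays
    and the successive choices built on it inside a prescribed set. *)
Lemma nested_basis (X : topologicalType) (A : set X) (x : X) :
  locally_connected_space X -> first_countable X ->
  open A -> connected A -> A x ->
  exists C : nat -> set X, [/\ C 0%N = A,
    forall n, [/\ open (C n), connected (C n) & C n x],
    forall m n, (m <= n)%N -> C n `<=` C m
  & forall N, nbhs x N -> exists n, C n `<=` N].
Proof.
move=> lcX fcX oA cA Ax; have [B [nB BP]] := fcX x.
have /choice[s sP] : forall N, exists V, nbhs x N ->
    [/\ open V, V x, V `<=` N & connected V].
  move=> N; have [nN|] := pselect (nbhs x N); last by exists set0.
  by have [V VP] := lcX _ _ nN; exists V.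
pose C := fix C n := if n is n'.+1 then s (C n' `&` B n') else A.
have CP n : [/\ open (C n), connected (C n) & C n x].
  elim: n => [|n [oC cC Cx]] //=.
  by have [] := sP (C n `&` B n) (filterI (nbhs_open oC Cx) (nB n)).
have CS n : C n.+1 `<=` C n `&` B n.
  have [oC _ Cx] := CP n.
  by have [] := sP (C n `&` B n) (filterI (nbhs_open oC Cx) (nB n)).
exists C; split=> //.
  move=> m n /subnK <-; elim: (n - m)%N => [//|k IH].
  by apply: subset_trans IH => y /CS[].
by move=> N /BP[n BN]; exists n.+1 => y /CS[_ /BN].
Qed.

(** [F n] runs through the first [n] paths at unit speed, and later stages change it only after time
    [n]. As [N u] exceeds [u], the limit coincides near [u] with [F (N u)], whence its
    continuity. *)
Lemma infinite_concatenation (X : topologicalType) (a : nat -> X)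
    (G : nat -> set X) :
  (forall m n, (m <= n)%N -> G n `<=` G m) ->
  (forall n, joined (G n) (a n) (a n.+1)) ->
  exists f : R -> X, [/\ continuous f, f 0 = a 0%N &
    forall n u, n%:R <= u -> G n (f u)].
Proof.
move=> Gdec /choice[g gP].
pose F := fix F n : R -> X := if n is m.+1 then
  (fun u => if u <= m%:R then F m u else g m (u - m%:R)) else (fun=> a 0%N).
have FE n : F n n%:R = a n.
  case: n => [//|n] /=; have /negbTE -> : ~~ (n.+1%:R <= n%:R :> R).
    by rewrite ler_nat -ltnNge.
  by rewrite -natrB // subSnn; have [] := gP n.
have Fc n : continuous (F n).
  elim: n => [|n IH]; first by move=> x; exact: cst_continuous.
  move=> x; apply: (@continuous_at_glue _ _ _ id (F n) (fun u => g n (u - n%:R))).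
  - exact: cvg_id.
  - by move=> _; exact: IH.
  - have [cg _ _ _] := gP n => _.
    have cs : {for x, continuous (fun u : R => u - n%:R)}.
      apply: (@continuousB _ _ _ (fun u : R => u) (fun=> n%:R)).
        exact: cvg_id.
      exact: cst_continuous.
    exact: (continuous_comp cs (cg _)).
  - by move=> /= ->; rewrite FE subrr; have [_ ->] := gP n.
have Fstab m n u : (m <= n)%N -> u <= m%:R -> F n u = F m u.
  move=> /subnK <- um; elim: (n - m)%N => [//|k IH] /=.
  by rewrite -IH (le_trans um) // ler_nat leq_addl.
have FG n m u : (n <= m)%N -> n%:R <= u -> u <= m%:R -> G n (F m u).
  move=> /subnK <- nu; elim: (m - n)%N => [|k IH] um.
    rewrite add0n in um *; have -> : u = n%:R by apply/le_anti; rewrite um nu.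
    by rewrite FE; have [_ <- _ +] := gP n; apply.
  rewrite /=; case: ifP => uk; first exact: IH.
  by have [_ _ _ /(_ (u - (k + n)%:R))] := gP (k + n)%N; apply: Gdec; rewrite leq_addl.
have [N NP] : {N : R -> nat | forall u, u < (N u)%:R}.
  exists (fun u => (Num.truncn u).+1) => u; exact: truncnS_gt.
have FNE m u : u <= m%:R -> F (N u) u = F m u.
  move=> um; have [mN|/ltnW Nm] := leqP m (N u); first exact: Fstab.
  by rewrite (Fstab (N u) m) // ltW.
exists (fun u => F (N u) u); split.
- move=> u; have cF := Fc (N u) u; move=> H; rewrite /= => Hu.
  have nF : nbhs u (F (N u) @^-1` H) := cF _ Hu.
  have nN : nbhs u [set v | v < (N u)%:R].
    by apply: nbhs_open; [exact: open_lt|exact: NP].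
  by apply: filterS2 nF nN => v /= Hv vN; rewrite (FNE (N u)) // ltW.
- by rewrite (FNE 0%N).
- move=> n u nu; apply: FG => //; last exact/ltW/NP.
  by rewrite -(ler_nat R) (le_trans nu) // ltW.
Qed.

(** The point [x] may lie outside [D]. Points of [D] are chosen in a shrinking basis at [x],
    successive ones are joined inside the connected traces of the [C n] on [D], and the infinitely
    many paths are run through in finite time. *)
Lemma portly_ray (X : topologicalType) (A D : set X) (x a : X) :
  standing_space R X -> open A -> connected A -> portly D -> A x ->
  (A `&` D) a ->
  exists g : R -> X, [/\ continuous g, g 0 = x, g 1 = a,
    forall t, A (g t) & forall t, 0 < t -> D (g t)].
Proof.
move=> [_ lpX fcX] oA cA [oD dD lD] Ax ADa.
have [C [C0 CP Cdec CN]] := nested_basis (lpc_locally_connected lpX) fcX oA cA Ax.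
have /choice[b bP] : forall n, exists b, (C n `&` D) b.
  by move=> n; have [oC _ Cx] := CP n; apply: dD => //; exists x.
pose c n := if n is 0%N then a else b n.
have cE n : (C n `&` D) (c n) by case: n => [|n] //; rewrite C0.
have [|n|f [cf f0 fG]] := @infinite_concatenation X c (fun n => C n `&` D).
- by move=> m n mn y [Cy Dy]; split=> //; exact: Cdec Cy.
- have [oC cC _] := CP n; apply: open_connected_joined => //.
  + exact: openI.
  + exact: lD.
  + by have [Cc Dc] := cE n.+1; split=> //; exact: (Cdec n n.+1).
have fC n u : n%:R <= u -> C n (f u) by move=> /fG[].
(* The change of time 1/t - 1 sends ]0, 1] onto the half-line from 0, with t = 1 giving [a];
   [Num.max] freezes the ray at [a] for t > 1. Since [f] stays in [C n] from time n on, that is for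
   t at most 1/(n + 1), the ray tends to [x] at 0. *)
exists (fun t => if t <= 0 then x else f (Num.max 0 (t^-1 - 1))); split.
- move=> t; have [t0|t0|->] := ltgtP t 0.
  + move=> G; rewrite /= (ltW t0) => Gx.
    have nt : nbhs t [set s | s < 0] by apply: nbhs_open; [exact: open_lt|exact: t0].
    apply: filterS nt => s /= s0; rewrite (ltW s0); exact: nbhs_singleton.
  + move=> G; rewrite /= leNgt t0 /= => Gx.
    have nt : nbhs t [set s | 0 < s] by apply: nbhs_open; [exact: open_gt|exact: t0].
    have cm : {for t, continuous (fun s : R => Num.max 0 (s^-1 - 1))}.
      have c0 : {for t, continuous ((fun=> 0) : R -> R)} by exact: cst_continuous.
      have c1 : {for t, continuous (fun s : R => s^-1 - 1)}.
        apply: (@continuousB _ _ _ (fun s : R => s^-1) (fun=> 1)).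
          by apply: inv_continuous; rewrite gt_eqF.
        exact: cst_continuous.
      exact: (continuous_max c0 c1).
    have nf : nbhs t ((fun s => f (Num.max 0 (s^-1 - 1))) @^-1` G).
      exact: (continuous_comp cm (cf _)).
    by apply: filterS2 nt nf => s /= s0 Gs; rewrite leNgt s0.
  + move=> G; rewrite /= lexx => /CN[n CG].
    have nt : nbhs 0 [set s : R | s < n.+1%:R^-1].
      by apply: nbhs_open; [exact: open_lt|rewrite /= invr_gt0 ltr0n].
    apply: filterS nt => s /= sn; apply: CG; case: ifP => s0.
      by have [_ _] := CP n.
    apply: fC; rewrite le_max; apply/orP; right.
    have s_gt0 : 0 < s by rewrite ltNge s0.
    rewrite lerBrDr -[_ + 1](natrD R n 1) addn1 -[n.+1%:R]invrK lef_pV2 ?posrE//.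
    exact: ltW.
- by rewrite lexx.
- by rewrite leNgt ltr01 /= invr1 subrr maxxx f0.
- move=> t; case: ifP => // _; rewrite -C0; apply: fC.
  by rewrite le_max lexx.
- move=> t t0; rewrite leNgt t0 /=; have [//|_] := fG 0%N (Num.max 0 (t^-1 - 1)).
    by rewrite le_max lexx.
  exact.
Qed.

End paths.

(** * Maps into complete spreads *)

Section spreads.
Variables (X Y : topologicalType) (p : X -> Y).

Lemma hausdorff_connected_eq (y y' : Y) :
  locally_connected_space Y -> hausdorff_space Y ->
  (forall U, open U -> connected U -> U y -> U y') -> y = y'.
Proof.
move=> lcY hY UU; apply: contrapT => neq.
have [A [B [oA oB Ay By' AB]]] := hausdorff_separate hY neq.
have [V [oV Vy VA cV]] := lcY _ _ (nbhs_open oA Ay).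
by apply: (AB y') => //; apply: VA; exact: UU.
Qed.

(** Components of preimages generate the topology, a priori only as a subbasis. They form a basis
    because a component over an intersection lies in the components over both sets: the [good] sets
    are then a topology containing the generators. *)
Lemma spread_basis (x : X) (N : set X) : spread p -> nbhs x N ->
  exists U, [/\ open U, U (p x) & connected_component (p @^-1` U) x `<=` N].
Proof.
move=> [cp genX] /nbhs_openP[G [oG Gx GN]].
pose good := [set A : set X | forall x, A x ->
  exists U, [/\ open U, U (p x) & connected_component (p @^-1` U) x `<=` A]].
suff : good G by move=> /(_ x Gx)[U [oU Ux UG]]; exists U; split=> // z /UG /GN.
move: oG; rewrite genX => /(_ good); apply; split; [split|].
- by move=> z _; exists setT; split=> //; exact: openT.
- move=> A B goodA goodB z [/goodA[U [oU Uz UA]] /goodB[V [oV Vz VB]]].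
  exists (U `&` V); split=> //; first exact: openI.
  move=> w zw; split; [apply: UA|apply: VB];
    by apply: connected_component_subset zw => ? [].
- move=> F Fgood z [A FA Az]; have [U [oU Uz UA]] := Fgood _ FA _ Az.
  by exists U; split=> // w /UA Aw; exists A.
- move=> C [U oU [c Uc <-]] z cz; exists U; split=> //.
    exact: (connected_component_sub cz).
  by rewrite (same_connected_component cz).
Qed.

Lemma spread_connected_basis (x : X) (N : set X) :
  locally_connected_space Y -> spread p -> nbhs x N ->
  exists U, [/\ open U, connected U, U (p x)
    & connected_component (p @^-1` U) x `<=` N].
Proof.
move=> lcY sp /(spread_basis sp)[U [oU Ux UN]].
have [V [oV Vx VU cV]] := lcY _ _ (nbhs_open oU Ux).
exists V; split=> // z xz; apply: UN.
by apply: connected_component_subset xz => ? /VU.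
Qed.

Lemma spread_eq (x x' : X) :
  locally_connected_space Y -> hausdorff_space X -> spread p ->
  (forall U, open U -> connected U -> U (p x) ->
     connected_component (p @^-1` U) x x') -> x = x'.
Proof.
move=> lcY hX sp UU; apply: contrapT => neq.
have [A [B [oA oB Ax Bx' AB]]] := hausdorff_separate hX neq.
have [U [oU cU Ux UA]] := spread_connected_basis lcY sp (nbhs_open oA Ax).
by apply: (AB x') => //; apply: UA; exact: UU.
Qed.

End spreads.

(** * Lifting maps from simply connected spaces *)

Section lifting_criterion.
Variables (R : realType) (W X Y : topologicalType) (p : X -> Y) (q : W -> Y).
Hypotheses (lcX : locally_connected_space X) (hX : hausdorff_space X).
Hypotheses (cp : continuous p) (cq : continuous q).
Hypothesis Oq : forall w, Ord_base p (q w).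

Lemma lift_cst (k : R -> X) (b : Y) (s s' : R) :
  continuous k -> Ord_base p b -> (forall t, p (k t) = b) -> k s = k s'.
Proof.
move=> ck Ob pk; apply: (lift_unique lcX cp (D := setT) (f := k)
  (g := fun=> k s') (a := s')) => //.
- exact: real_connectedT.
- by move=> z _; exact: ck.
- by move=> z _; exact: cst_continuous.
- by move=> z _; rewrite !pk.
- by move=> z _; rewrite pk.
Qed.

(* Paths in the fibre product of q and p are paths in W together with a lift to X;
   the lift of a null-homotopic loop is closed. *)
Lemma monodromy_trivial (w0 w : W) (x0 x x' : X) :
  simply_connected R W ->
  joined R [set z : W * X | p z.2 = q z.1] (w0, x0) (w, x) ->
  joined R [set z : W * X | p z.2 = q z.1] (w0, x0) (w, x') -> x = x'.
Proof.
move=> [_ scW] [G [cG G0 G1 EG]] [G' [cG' G'0 G'1 EG']].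
have cG1 : continuous (fst \o G).
  by move=> t; apply: continuous_comp; [exact: cG|exact: cvg_fst].
have cG2 : continuous (snd \o G).
  by move=> t; apply: continuous_comp; [exact: cG|exact: cvg_snd].
have cG'1 : continuous (fst \o G').
  by move=> t; apply: continuous_comp; [exact: cG'|exact: cvg_fst].
have cG'2 : continuous (snd \o G').
  by move=> t; apply: continuous_comp; [exact: cG'|exact: cvg_snd].
have G11 : (G 1).1 = (G' 1).1 by rewrite G1 G'1.
have [l [cl lG lG']] := concat_rev cG1 cG'1 G11.
have l0 : l 0 = w0 by rewrite lG /= ?mulr0 ?G0 // invr_ge0 ler0n.
have l1 : l 1 = w0.
  rewrite lG' /=; last by lra.
  have -> : 2 - 2 * 1 = 0 :> R by lra.
  by rewrite G'0.
have [|h [ch h0 h1 he _]] := scW w0 l.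
  by split=> //; exact: continuous_subspaceT.
have [k [ck k0 pk]] : exists k : R -> X, [/\ continuous k, k 0 = x0 &
    forall s, p (k s) = q (l (clamp s))].
  apply: (@path_lift R X Y p (q \o l)) => //.
  - by move=> t; apply: continuous_comp; [exact: cl|exact: cq].
  - by move=> s; exact: Oq.
  - by rewrite /= l0; have := EG 0; rewrite G0.
have c01 (s : R) : 0 <= clamp s <= 1 by rewrite clamp_ge0 clamp_le1.
have [||||||K KP] := @homotopy_lift R X Y p lcX hX cp R setT
    (fun z => q (h (clamp z.1, clamp z.2))) k.
- exact: openT.
- move=> s t _; have chc := @within01_clamp2 _ _ _ ch (s, t).
  exact: (continuous_comp chc (@cq _)).
- by move=> s t _ /=; rewrite clampK.
- by move=> s t _; exact: Oq.
- by move=> t _; exact: ck.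
- by move=> t _; rewrite /= clamp0 h0.
have cK1 t : continuous (fun s => K (s, t)).
  by move=> s; have [_ /(_ s)[/slice_continuous[]]] := KP t I.
have cK2 s : continuous (fun t => K (s, t)).
  by move=> t; have [_ /(_ s)[/slice_continuous[]]] := KP t I.
have pK s t : p (K (s, t)) = q (h (clamp s, clamp t)).
  by have [_ /(_ s)[]] := KP t I.
(* [K] extends [k] from the side s = 0 of the square. The other three sides project to the single
   point [q w0], so [K] is constant along them and [k] closes up. *)
have k1 : k 1 = x0.
  have e1 : K (0, 1) = K (1, 1).
    apply: (lift_cst 0 1 (cK1 1) (Oq w0)).
    by move=> s; rewrite pK clamp1 (he _ (c01 s)).2.
  have e2 : K (1, 1) = K (1, 0).
    apply: (lift_cst 1 0 (cK2 1) (Oq w0)).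
    by move=> t; rewrite pK clamp1 h1.
  have e3 : K (1, 0) = K (0, 0).
    apply: (lift_cst 1 0 (cK1 0) (Oq w0)).
    by move=> s; rewrite pK clamp0 (he _ (c01 s)).1.
  by have [<- _] := KP 1 I; have [K00 _] := KP 0 I; rewrite e1 e2 e3 K00.
have cc2 (t : R) : {for t, continuous (fun u : R => clamp u * 2^-1)}.
  have c2 : continuous (fun u : R => u * 2^-1) by move=> u; exact: mulrr_continuous.
  exact: (continuous_comp (@clamp_continuous R t) (c2 _)).
have half (s : R) : 0 <= clamp s * 2^-1 <= 1.
  by have /andP[? ?] := c01 s; apply/andP; split; lra.
(* By uniqueness, [k] follows the lift contained in [G] on its first half and, read backwards from
   its closed end, the lift contained in [G'] on its second half. They meet at 1/2, where the values
   are [x] and [x']. *)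
have kx : k (clamp 1 * 2^-1) = (G (clamp 1)).2.
  apply: (lift_unique lcX cp (D := setT) (a := 0)
    (f := fun t => k (clamp t * 2^-1)) (g := fun t => (G (clamp t)).2)) => //.
  - exact: real_connectedT.
  - by move=> t _; exact: (continuous_comp (cc2 t) (ck _)).
  - by move=> t _; exact: (continuous_comp (@clamp_continuous R t) (cG2 _)).
  - move=> t _; rewrite pk EG (clamp_id (half t)) lG /=.
      by congr (q (G _).1); lra.
    by have /andP[? ?] := c01 t; lra.
  - by move=> t _; rewrite pk; exact: Oq.
  - by rewrite clamp0 mul0r k0 G0.
have cc2' (t : R) : {for t, continuous (fun u : R => 1 - clamp u * 2^-1)}.
  apply: (@continuousB R R R (fun=> 1) (fun u : R => clamp u * 2^-1)).
    exact: cst_continuous.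
  exact: cc2.
have kx' : k (1 - clamp 1 * 2^-1) = (G' (clamp 1)).2.
  apply: (lift_unique lcX cp (D := setT) (a := 0)
    (f := fun t => k (1 - clamp t * 2^-1)) (g := fun t => (G' (clamp t)).2)) => //.
  - exact: real_connectedT.
  - by move=> t _; exact: (continuous_comp (cc2' t) (ck _)).
  - by move=> t _; exact: (continuous_comp (@clamp_continuous R t) (cG'2 _)).
  - move=> t _; have /andP[? ?] := c01 t.
    rewrite pk EG' clamp_id; last by apply/andP; split; lra.
    by rewrite lG' /=; [congr (q (G' _).1); lra|lra].
  - by move=> t _; rewrite pk; exact: Oq.
  - by rewrite clamp0 mul0r subr0 k1 G'0.
move: kx kx'; rewrite clamp1 G1 G'1 mul1r /= => <- <-; congr k; lra.
Qed.

(** [f w] is the end of the lift of any path from [w0] to [w], which is well defined by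
    [monodromy_trivial]. Inside a path connected [V] around [w] paths are prolonged, and their lifts
    follow the section [s]; so [f] is [s \o q] there, which gives continuity. *)
Lemma lifting_criterion (w0 : W) (x0 : X) :
  locally_path_connected R W -> simply_connected R W -> p x0 = q w0 ->
  exists f : W -> X, [/\ continuous f, forall w, p (f w) = q w & f w0 = x0].
Proof.
move=> lpW scW px0; pose E := [set z : W * X | p z.2 = q z.1].
have /choice[f fP] : forall w, exists x, joined R E (w0, x0) (w, x).
  move=> w; have [g /joined_path_in[{}g [cg g0 g1 _]]] := scW.1 w0 w I I.
  have [|||k [ck k0 pk]] := @path_lift R X Y p (q \o g) x0 lcX hX cp.
  - by move=> t; apply: continuous_comp; [exact: cg|exact: cq].
  - by move=> s; exact: Oq.
  - by rewrite /= g0.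
  exists (k 1), (fun t => (g (clamp t), k t)); split.
  - move=> t; apply: continuous_pair; last exact: ck.
    exact: (continuous_comp (@clamp_continuous R t) (cg _)).
  - by rewrite clamp0 g0 k0.
  - by rewrite clamp1 g1.
  - by move=> t; rewrite /E /= pk.
have pf w : p (f w) = q w.
  by have [G [_ _ G1 EG]] := fP w; have := EG 1; rewrite G1.
have fE w x : joined R E (w0, x0) (w, x) -> f w = x.
  exact: (monodromy_trivial scW (fP w)).
exists f; split=> //; last first.
  by apply: fE; exists (fun=> (w0, x0)); split=> // ?; exact: cst_continuous.
move=> w; have [U [oU Uw sheetU]] := Ord_base_sheet lcX cp (Oq w).
have [|C [s [oC Cf CU sU sC]]] := sheetU (f w); first by rewrite pf.
have qU : nbhs w (q @^-1` U) by apply: cq; exact: nbhs_open.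
have [V [oV Vw VU pV]] := lpW _ _ qU.
have fs w' : V w' -> s (q w') = f w'.
  move=> Vw'; apply/esym/fE; apply: (joined_trans (fP w)).
  have [g /joined_path_in] := pV _ _ Vw Vw'.
  rewrite -[f w]sC // pf.
  apply: (joined_image (f := fun v => (v, s (q v)))) => v Vv.
  have [_ ps cs] := sU _ (VU _ Vv); split; last by rewrite /E /= ps.
  apply: continuous_pair; first exact: cvg_id.
  exact: (continuous_comp (@cq v) cs).
have [_ _ cs] := sU _ Uw; move=> G; rewrite /= -fs // => Gf.
have nG : nbhs w ((s \o q) @^-1` G) := continuous_comp (@cq w) cs Gf.
by apply: filterS2 nG (nbhs_open oV Vw) => v /= + Vv; rewrite fs.
Qed.

End lifting_criterion.

(* The value at z is the point common to the components over the neighborhoods U of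
   pt z that contain the image of the part of W lying in the component of z. *)
Lemma extend_over (W Yt X Y : topologicalType) (i : W -> Yt) (pt : Yt -> Y)
    (p : X -> Y) (f : W -> X) :
  locally_connected_space Yt -> locally_connected_space Y ->
  hausdorff_space X -> hausdorff_space Y ->
  continuous pt -> complete_spread p ->
  (forall z, closure (range p) (pt z)) ->
  continuous f -> (forall w, p (f w) = pt (i w)) ->
  (forall A, open A -> connected A -> A !=set0 ->
     connected (i @^-1` A) /\ i @^-1` A !=set0) ->
  exists F : Yt -> X,
    [/\ continuous F, forall z, p (F z) = pt z & forall w, F (i w) = f w].
Proof.
move=> lcYt lcY hX hY cpt [sp completep] clp cf pf cut.
pose Z z U := connected_component (pt @^-1` U) z.
pose chi z U := [set x | exists2 w, Z z U (i w) &
  connected_component (p @^-1` U) (f w) x].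
have oZ z U : open U -> open (Z z U).
  by move=> oU; apply: connected_component_open => //; move/continuousP: cpt; apply.
(* The trace of [Z z U] on [W] is connected, so [f] sends it into one component over [U], whichever
   [w] names it; this makes [chi z U] a component. *)
have chiE z U w : open U -> Z z U (i w) ->
    chi z U = connected_component (p @^-1` U) (f w).
  move=> oU Zw; have zU : U (pt z).
    exact: (connected_component_sub (connected_component_sym Zw)).
  have Zz : Z z U z by exact: connected_component_refl.
  have [ci _] := cut _ (oZ z U oU) (@component_connected _ _ _) (ex_intro _ z Zz).
  have cfi : connected (f @` (i @^-1` (Z z U))).
    by apply: connected_image => // v _; exact: cf.
  have sub : f @` (i @^-1` (Z z U)) `<=` p @^-1` U.
    by move=> _ [v Zv <-] /=; rewrite pf; exact: (connected_component_sub Zv).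
  have ww v : Z z U (i v) -> connected_component (p @^-1` U) (f w) (f v).
    by move=> Zv; apply: (connected_component_max _ sub cfi); [exists w|exists v].
  apply/seteqP; split=> [x [v Zv vx]|x wx]; last by exists w.
  by apply: connected_component_trans vx; exact: ww.
have chi_comp z U : open U -> U (pt z) -> exists2 w, Z z U (i w) & U (p (f w)).
  move=> oU Uz; have Zz : Z z U z by exact: connected_component_refl.
  have [_ [w Zw]] := cut _ (oZ z U oU) (@component_connected _ _ _) (ex_intro _ z Zz).
  by exists w => //; rewrite pf; exact: (connected_component_sub Zw).
have /choice[F FP] : forall z, exists x, forall U, open U -> connected U ->
    U (pt z) -> chi z U x.
  move=> z; have [||x xP] := completep (pt z) (clp z) (chi z).
  - move=> U [oU cU Uz]; have [w Zw Uw] := chi_comp _ _ oU Uz.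
    by exists (f w) => //; rewrite (chiE _ _ w).
  - move=> U V [oU cU Uz] [oV cV Vz] UV x [w Zw wx].
    by exists w; [apply: connected_component_subset Zw => ? /UV
                 |apply: connected_component_subset wx => ? /UV].
  - by exists x => U oU cU Uz; apply: xP.
have pF z : p (F z) = pt z.
  apply/esym/(hausdorff_connected_eq lcY hY) => U oU cU Uz.
  by have [w _ /connected_component_sub] := FP z U oU cU Uz.
exists F; split=> // [z G FG|w]; last first.
  apply/esym/(spread_eq lcY hX sp) => U oU cU; rewrite pf => Uw.
  have := FP (i w) U oU cU Uw; rewrite (chiE _ _ w) //.
  exact: connected_component_refl.
have [U [oU cU Uz UG]] := spread_connected_basis lcY sp FG.
rewrite pF in Uz; have Zz : Z z U z by exact: connected_component_refl.
apply: filterS (nbhs_open (oZ z U oU) Zz) => z' zz'; apply: UG.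
have Uz' : U (pt z') by exact: (connected_component_sub zz').
have [w Zw _] := chi_comp _ _ oU Uz.
have Zw' : Z z' U (i w) by rewrite /Z -(same_connected_component zz').
have := FP z U oU cU Uz; rewrite (chiE _ _ w) // => wx.
have := FP z' U oU cU Uz'; rewrite (chiE _ _ w) // => wx'.
exact: connected_component_trans (connected_component_sym wx) wx'.
Qed.

Lemma connected_component_image (S X : topologicalType) (D : set S) (A : set X)
    (f : S -> X) (a b : S) :
  connected D -> (forall s, D s -> {for s, continuous f} /\ A (f s)) ->
  D a -> D b -> connected_component A (f a) (f b).
Proof.
move=> cD fD Da Db; exists (f @` D); last by exists b.
split; [by exists a|by move=> _ [s Ds <-]; exact: (fD _ Ds).2|].
by apply: connected_image => // s /fD[].
Qed.

Lemma connected_component_over (Z X Y : topologicalType) (q : Z -> Y)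
    (p : X -> Y) (F : Z -> X) (U : set Y) (z z' : Z) :
  continuous F -> (forall z, p (F z) = q z) ->
  connected_component (q @^-1` U) z z' ->
  connected_component (p @^-1` U) (F z) (F z').
Proof.
move=> cF pF [A [Az AU cA] Az'].
apply: (connected_component_image cA) => // s As; split; first exact: cF.
by rewrite /= pF; exact: AU.
Qed.

(** The tube lemma for the compact segment of times. It will be applied at the fixed ends of a
    homotopy, where the whole column is one point. *)
Lemma tube (R : realType) (Y : topologicalType) (h : R * R -> Y) (U : set Y)
    (t0 : R) :
  continuous h -> open U -> (forall s, 0 <= s <= 1 -> U (h (s, t0))) ->
  exists2 e, 0 < e & forall s t, 0 <= s <= 1 -> ball t0 e t -> U (h (s, t)).
Proof.
move=> ch oU hU.
have cI : compact `[(0:R), 1] by exact: segment_compact.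
have /compact_near_coveringP := cI.
move=> /(_ R (nbhs t0) (fun t s => U (h (s, t))) _)[].
  move=> s sI; have : nbhs (s, t0) (h @^-1` U).
    by apply: ch; apply: nbhs_open => //; apply: hU; move: sI; rewrite /= in_itv.
  by move=> H; apply: filterS H => -[a b].
move=> e /= e0 eP; exists e => // s t sI te.
by apply: (eP _ te); rewrite /= in_itv.
Qed.

(** * Fibres over the branch set *)

Section unbranched.
Variables (R : realType) (Y : topologicalType) (Y0 : set Y).
Hypotheses (spaceY : standing_space R Y) (pY0 : portly Y0).

(** The common ground of the universal covering and of the given coverings: the lemmas below serve
    for both, and for [pt] as source and target at once when deck transformations are produced. *)
Definition unbranched_over (X : topologicalType) (p : X -> Y) :=
  [/\ standing_space R X, complete_spread p, Y0 `<=` Ord_base p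
    & portly (p @^-1` Y0)].

Let lpY : locally_path_connected R Y. Proof. by case: spaceY. Qed.
Let lcY : locally_connected_space Y. Proof. exact: lpc_locally_connected lpY. Qed.
Let hY : hausdorff_space Y. Proof. by case: spaceY. Qed.
Let oY0 : open Y0. Proof. by case: pY0. Qed.
Let dY0 : dense Y0. Proof. by case: pY0. Qed.
Let lY0 : locally_connected_in Y0. Proof. by case: pY0. Qed.

Section over.
Variables (X : topologicalType) (p : X -> Y).
Hypothesis up : unbranched_over p.

Let lpX : locally_path_connected R X. Proof. by case: up => -[]. Qed.
Let lcX : locally_connected_space X. Proof. exact: lpc_locally_connected lpX. Qed.
Let hX : hausdorff_space X. Proof. by case: up => -[]. Qed.
Let sp : spread p. Proof. by case: up => _ []. Qed.
Let cp : continuous p. Proof. by case: sp. Qed.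
Let completep : complete_map p. Proof. by case: up => _ []. Qed.
Let Y0O : Y0 `<=` Ord_base p. Proof. by case: up. Qed.
Let pX0 : portly (p @^-1` Y0). Proof. by case: up. Qed.

Let open_preimage U : open U -> open (p @^-1` U).
Proof. by move=> oU; move/continuousP: cp; apply. Qed.

Lemma component_meets (U : set Y) (x : X) : open U -> U (p x) ->
  exists2 x', connected_component (p @^-1` U) x x' & Y0 (p x').
Proof.
move=> oU Ux; have [_ dX0 _] := pX0.
have [||x' [xx' Yx']] := dX0 (connected_component (p @^-1` U) x).
- by exists x; exact: connected_component_refl.
- by apply: connected_component_open => //; exact: open_preimage.
- by exists x'.
Qed.

Lemma joined_lift (U : set Y) (b : Y) (x : X) :
  joined R (U `&` Y0) (p x) b ->
  exists2 x', connected_component (p @^-1` U) x x' & p x' = b.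
Proof.
move=> [g [cg g0 g1 Ug]].
have [||k [ck k0 pk]] := @path_lift R X Y p g x lcX hX cp cg.
- by move=> s; apply: Y0O; exact: (Ug s).2.
- by rewrite g0.
exists (k 1); last by rewrite pk clamp1.
rewrite -{1}k0; apply: (connected_component_image (@real_connectedT R)) => // s _.
by split; [exact: ck|rewrite /= pk; exact: (Ug _).1].
Qed.

Lemma component_reaches (V U : set Y) (x : X) :
  open V -> connected V -> V (p x) -> Y0 (p x) ->
  open U -> U `<=` V -> U !=set0 ->
  exists x', [/\ connected_component (p @^-1` V) x x', U (p x') & Y0 (p x')].
Proof.
move=> oV cV Vx Y0x oU UV /dY0/(_ oU)[b [Ub Yb]].
have /joined_lift[x' xx' px'] : joined R (V `&` Y0) (p x) b.
  apply: open_connected_joined => //; [exact: openI|exact: lY0|].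
  by split=> //; exact: UV.
by exists x'; rewrite px'.
Qed.

(* Shrinking V to y while following components gives a monotone choice of
   components, to which completeness applies. *)
Lemma component_point (V : set Y) (y : Y) (x : X) :
  open V -> connected V -> V y -> V (p x) ->
  exists2 x', connected_component (p @^-1` V) x x' & p x' = y.
Proof.
move=> oV cV Vy Vx; have [x1 xx1 Yx1] := component_meets oV Vx.
have [_ _ fcY] := spaceY.
have [C [C0 CP Cdec CN]] := nested_basis lcY fcY oV cV Vy.
have /choice[s sP] : forall nx : nat * X, exists x',
    C nx.1 (p nx.2) -> Y0 (p nx.2) ->
    [/\ connected_component (p @^-1` (C nx.1)) nx.2 x', C nx.1.+1 (p x') & Y0 (p x')].
  move=> [n a] /=; have [[Ca Ya]|nCY] := pselect (C n (p a) /\ Y0 (p a)).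
    have [oC cC _] := CP n; have [oC' _ Cy'] := CP n.+1.
    have [||a' aP] := @component_reaches (C n) (C n.+1) a oC cC Ca Ya oC'.
    - exact: Cdec.
    - by exists y.
    - by exists a'.
  by exists a => Ca Ya; exfalso; apply: nCY.
pose b := fix b n := if n is m.+1 then s (m, b m) else x1.
have bP n : C n (p (b n)) /\ Y0 (p (b n)).
  elim: n => [|n [Cb Yb]] /=.
    by rewrite C0; split=> //; exact: (connected_component_sub xx1).
  by have [] := sP (n, b n) Cb Yb.
have bS n m : (n <= m)%N -> connected_component (p @^-1` (C n)) (b n) (b m).
  move=> /subnK <-; elim: (m - n)%N => [|k IH].
    by apply: connected_component_refl; exact: (bP n).1.
  apply: (connected_component_trans IH); have [Cb Yb] := bP (k + n)%N.
  have [H _ _] := sP (k + n, b (k + n))%N Cb Yb.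
  apply: connected_component_subset H => a; apply: Cdec.
  exact: leq_addl.
have bU U n m : C n `<=` U -> C m `<=` U ->
    connected_component (p @^-1` U) (b n) (b m).
  wlog nm : n m / (n <= m)%N.
    move=> H nU mU; have [nm|/ltnW mn] := leqP n m; first exact: H.
    by apply: connected_component_sym; exact: H.
  by move=> nU _; apply: connected_component_subset (bS _ _ nm) => a /nU.
(* All points [b n] with [C n] inside [U] lie in one component over [U], and that component is
   selected. A larger [U] admits the same indices, whence monotonicity. *)
pose chi U := [set a | exists2 n, C n `<=` U & connected_component (p @^-1` U) (b n) a].
have [|||x' x'P] := completep (y := y) _ (chi := chi).
- move=> N /CN[n CnN]; exists (p (b n)); split; first by exists (b n).
  by apply: CnN; exact: (bP n).1.
- move=> U [oU cU Uy]; have [n nU] := CN _ (nbhs_open oU Uy).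
  exists (b n); first by apply: nU; exact: (bP n).1.
  apply/seteqP; split=> [a na|a [m mU ma]]; first by exists n.
  exact: connected_component_trans (bU _ _ _ nU mU) ma.
- move=> U U' _ _ UU' a [n nU na]; exists n; first exact: subset_trans UU'.
  by apply: connected_component_subset na => c /UU'.
exists x'.
  have [n nV nx'] := x'P V (And3 oV cV Vy).
  apply: (connected_component_trans xx1); apply: connected_component_trans nx'.
  by apply: (bU V 0%N) => //; rewrite C0.
apply/esym/(hausdorff_connected_eq lcY hY) => U oU cU Uy.
by have [n _ /connected_component_sub] := x'P U (And3 oU cU Uy).
Qed.

Definition slsc_nbhs (y : Y) (V : set Y) :=
  [/\ open V, connected V, V y &
      forall g : R -> Y, Omega y (V `&` Y0) g -> almost_trivial y Y0 g].

(* The loop obtained by projecting a path from x to x' through the unbranched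
   part is homotopic to loops in arbitrarily small U; lifting such a homotopy
   joins x to x' over U, and these components separate points. *)
Lemma component_point_unique (V : set Y) (y : Y) (x x' : X) :
  slsc_nbhs y V -> p x = y -> p x' = y ->
  connected_component (p @^-1` V) x x' -> x = x'.
Proof.
move=> [oV cV Vy trivV] px px' xx'.
have Vx : V (p x) by rewrite px.
pose A := connected_component (p @^-1` V) x.
have oA : open A by apply: connected_component_open => //; exact: open_preimage.
have cA : connected A by exact: component_connected.
have Ax : A x by exact: connected_component_refl.
have [a Aa Ya] := component_meets oV Vx.
have [sX _ _ _] := up.
(* Only the starts of the two rays may lie over [S], so the path [l] from [x] through [a] to [x']
   projects to a loop of [Omega]. *)
have [g [cg g0 g1 Ag Yg]] := portly_ray sX oA cA pX0 Ax (conj Aa Ya).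
have [g' [cg' g'0 g'1 Ag' Yg']] := portly_ray sX oA cA pX0 xx' (conj Aa Ya).
have g11 : g 1 = g' 1 by rewrite g1.
have [l [cl lg lg']] := concat_rev cg cg' g11.
have l0 : l 0 = x by rewrite lg ?mulr0 // invr_ge0 ler0n.
have l1 : l 1 = x'.
  rewrite lg'; last by lra.
  by have -> : 2 - 2 * 1 = 0 :> R by lra.
have Al t : A (l t).
  by have [t2|/ltW t2] := leP t 2^-1; [rewrite lg|rewrite lg'].
have Yl t : 0 < t < 1 -> Y0 (p (l t)).
  move=> /andP[t0 t1]; have [t2|/ltW t2] := leP t 2^-1.
    by rewrite lg //; apply: Yg; lra.
  by rewrite lg' //; apply: Yg'; lra.
have Opl : Omega y (V `&` Y0) (p \o l).
  split => /=; rewrite ?l0 ?l1 //.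
    by apply: continuous_subspaceT => t; exact: (continuous_comp (cl t) (@cp _)).
  move=> t t01; split; last exact: Yl.
  exact: (connected_component_sub (Al t)).
apply: (spread_eq lcY hX sp) => U oU cU; rewrite px => Uy.
have [g1' [_ _ _ Ug1] [h [ch h0 h1 he hY0]]] := trivV _ Opl U oU Uy.
pose H (z : R * R) := h (clamp z.1, clamp z.2).
have cH : continuous H by exact: within01_clamp2.
pose D : set R := [set t | 0 < t < 1].
have oD : open D.
  rewrite /D (_ : [set t | _] = `]0, 1[%classic); first exact: interval_open.
  by apply/seteqP; split=> t; rewrite /= in_itv.
have c01 (s : R) : 0 <= clamp s <= 1 by rewrite clamp_ge0 clamp_le1.
have cD t : D t -> clamp t = t.
  by move=> /andP[t0 t1]; apply: clamp_id; rewrite !ltW.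
(* Only the parameters in ]0, 1[ are lifted: at both ends the homotopy stays at [y], which may be a
   branch point. *)
have [|||||K KP] := @homotopy_lift R X Y p lcX hX cp R D H l oD.
- by move=> s t _; exact: cH.
- by move=> s t _; rewrite /H /= clampK.
- by move=> s t Dt; apply: Y0O; apply: hY0 => //=; rewrite cD.
- by move=> t _; exact: cl.
- by move=> t Dt; rewrite /H /= clamp0 cD // h0 //; case/andP: Dt => *; rewrite !ltW.
(* Near an end the tube lemma keeps the homotopy in [U] at all times. Hence going from the end of
   [l] to a nearby [l t], and then along the lifted homotopy to its final curve, stays in one
   component over [U]. The final curve lies entirely over [U] and connects the two links. *)
have link (t0 : R) : t0 = 0 \/ t0 = 1 -> H (0, t0) = p (l t0) /\
    exists2 t, D t & connected_component (p @^-1` U) (l t0) (K (1, t)).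
  move=> t0P.
  have t001 : 0 <= t0 <= 1 by case: t0P => ->; rewrite lexx ler01.
  have H0 : forall t, 0 <= t <= 1 -> H (0, t) = p (l t).
    by move=> t t01; rewrite /H /= clamp0 clamp_id // h0.
  split; first exact: H0.
  have [s _|e e0 eU] := tube (t0 := t0) cH oU.
    by case: t0P => ->; rewrite /H /= ?clamp0 ?clamp1 ?(he _ (c01 s)).1 ?(he _ (c01 s)).2.
  have [t [Dt te]] : exists t, D t /\ ball t0 e t.
    pose d := Num.min (2^-1) (e / 2).
    have d0 : 0 < d by rewrite lt_min divr_gt0 // invr_gt0 ltr0n.
    have d2 : d <= 2^-1 by rewrite ge_min lexx.
    have de : d < e by rewrite gt_min; apply/orP; right; lra.
    case: t0P => ->; [exists d|exists (1 - d)]; split.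
    - by rewrite /D /= d0 /=; lra.
    - by rewrite -ball_normE /= sub0r normrN gtr0_norm.
    - by rewrite /D /=; apply/andP; split; lra.
    - rewrite -ball_normE /=; have -> : 1 - (1 - d) = d by lra.
      by rewrite gtr0_norm.
  exists t => //; have [K0 Kt] := KP t Dt.
  have l0t : connected_component (p @^-1` U) (l t0) (l t).
    pose J : set R := [set s | ball t0 e s /\ 0 <= s <= 1].
    apply: (@connected_component_image _ _ J) => //.
    - apply/connected_intervalP => u v [tu /andP[u0 u1]] [tv /andP[v0 v1]] w /andP[uw wv].
      split; first exact: (ball_interval tu tv).
      by rewrite (le_trans u0) // (le_trans wv).
    - move=> s [ts s01]; split; first exact: cl.
      by rewrite /= -H0 //; apply: eU => //; rewrite lexx ler01.
    - by split=> //; exact: ballxx.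
    - by split=> //; case/andP: Dt => *; rewrite !ltW.
  apply: connected_component_trans l0t _; rewrite -K0.
  apply: (@connected_component_image _ _ setT _ (fun s => K (s, t))) => //.
    exact: real_connectedT.
  move=> s _; have [cK pK] := Kt s; split; first exact: (slice_continuous cK).1.
  rewrite /= pK; have -> : H (s, t) = H (clamp s, t) by rewrite /H /= clampK.
  exact: eU.
have [_ [t0 Dt0 xK]] := link 0 (or_introl erefl).
have [_ [t1 Dt1 x'K]] := link 1 (or_intror erefl).
rewrite -l0 -l1; apply: connected_component_trans xK _.
apply: connected_component_trans (connected_component_sym x'K).
apply: (@connected_component_image _ _ D _ (fun t => K (1, t))) => //.
  apply/connected_intervalP => u v /andP[u0 u1] /andP[v0 v1] w /andP[uw wv].
  by rewrite /D /= (lt_le_trans u0) // (le_lt_trans wv).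
move=> t Dt; have [_ /(_ 1)[cK pK]] := KP t Dt.
split; first exact: (slice_continuous cK).2.
rewrite /= pK /H /= clamp1 cD // h1.
  by case: (Ug1 t Dt).
by case/andP: Dt => *; rewrite !ltW.
Qed.

End over.
End unbranched.

(** * Maps over the base and deck transformations *)

Section maps_over.
Variables (R : realType) (Y : topologicalType) (Y0 : set Y).
Hypotheses (spaceY : standing_space R Y) (pY0 : portly Y0).
Hypothesis slscY0 : forall y, semi_locally_simply_connected_at R Y0 y.

Let lcY : locally_connected_space Y.
Proof. by case: spaceY => _ lpY _; exact: lpc_locally_connected lpY. Qed.

Lemma unbranched_locally_connected (X : topologicalType) (p : X -> Y) :
  unbranched_over R Y0 p -> locally_connected_space X.
Proof. by case=> -[_ lpX _] _ _ _; exact: lpc_locally_connected lpX. Qed.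

Lemma unbranched_continuous (X : topologicalType) (p : X -> Y) :
  unbranched_over R Y0 p -> continuous p.
Proof. by case=> _ [[]]. Qed.

Lemma unbranched_component_open (X : topologicalType) (p : X -> Y) (U : set Y)
    (x : X) :
  unbranched_over R Y0 p -> open U -> open (connected_component (p @^-1` U) x).
Proof.
move=> up oU; apply: connected_component_open.
  exact: unbranched_locally_connected up.
by have /continuousP := unbranched_continuous up; apply.
Qed.

(** Shrinking is harmless: loops in the smaller set are loops in [V], and almost triviality refers
    to [Y0] but not to [V]. *)
Lemma small_slsc_nbhs (y : Y) (U : set Y) : nbhs y U ->
  exists2 V, slsc_nbhs R Y0 y V & V `<=` U.
Proof.
move=> nU; have [V [oV _ Vy trivV]] := slscY0 y.
have [V' [oV' V'y V'UV cV']] := lcY (filterI nU (nbhs_open oV Vy)).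
exists V'; last by move=> z /V'UV[].
split=> // g [cg g0 g1 Vg]; apply: trivV; split=> // t /Vg[/V'UV[_ Vt] Yt].
by split.
Qed.

(** The part of [Z] over [Y0] is connected, being the trace of the connected open set [Z] on a
    portly set. So [lift_unique] spreads the agreement over it, and density does the rest. *)
Lemma over_unique (Z X : topologicalType) (q : Z -> Y) (p : X -> Y)
    (F F' : Z -> X) (z : Z) :
  unbranched_over R Y0 q -> unbranched_over R Y0 p -> connected [set: Z] ->
  continuous F -> continuous F' ->
  (forall z, p (F z) = q z) -> (forall z, p (F' z) = q z) ->
  Y0 (q z) -> F z = F' z -> F = F'.
Proof.
move=> [_ _ _ [oZ0 dZ0 lZ0]] up cZ cF cF' pF pF' Yz Fz.
have [[hX _ _] _ Y0O _] := up.
apply: (eq_of_dense hX cF cF' dZ0).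
apply: (lift_unique (unbranched_locally_connected up) (unbranched_continuous up)
  (a := z) hX) => //.
- by rewrite -[_ @^-1` _]setTI; apply: lZ0 => //; exact: openT.
- by move=> w _; exact: cF.
- by move=> w _; exact: cF'.
- by move=> w _; rewrite pF pF'.
- by move=> w Yw; rewrite pF; exact: Y0O.
Qed.

Section covering_map.
Variables (Z X : topologicalType) (q : Z -> Y) (p : X -> Y) (F : Z -> X).
Hypotheses (uq : unbranched_over R Y0 q) (up : unbranched_over R Y0 p).
Hypotheses (cF : continuous F) (pF : forall z, p (F z) = q z).

(* Over Y0 by path lifting; elsewhere because both components contain a unique
   point over p x once U is small. *)
Lemma component_lift (U : set Y) (z : Z) (x : X) : open U ->
  connected_component (p @^-1` U) (F z) x ->
  exists2 z', connected_component (q @^-1` U) z z' & F z' = x.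
Proof.
move=> oU Fzx.
have Uz : U (q z) by rewrite -pF; exact: (connected_component_sub (connected_component_sym Fzx)).
wlog Yx : x Fzx / Y0 (p x).
  move=> unram; have Ux : U (p x) := connected_component_sub Fzx.
  have [V V_slsc VU] := small_slsc_nbhs (nbhs_open oU Ux).
  have [oV cV Vx _] := V_slsc.
  have [x1 xx1 Yx1] := component_meets up oV Vx.
  have xx1U := connected_component_subset (preimage_subset VU) xx1.
  have [z1 zz1 Fz1] := unram x1 (connected_component_trans Fzx xx1U) Yx1.
  have Vz1 : V (q z1) by rewrite -pF Fz1; exact: (connected_component_sub xx1).
  have [z2 z12 qz2] := component_point spaceY pY0 uq oV cV Vx Vz1.
  exists z2.
    apply: (connected_component_trans zz1).
    exact: (connected_component_subset (preimage_subset VU) z12).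
  apply: (component_point_unique spaceY up V_slsc) => //; first by rewrite pF.
  apply: connected_component_sym; apply: (connected_component_trans xx1).
  by rewrite -Fz1; exact: connected_component_over z12.
have [z1 zz1 Yz1] := component_meets uq oU Uz.
have Fz1x : connected_component (p @^-1` U) (F z1) x.
  apply: connected_component_trans Fzx; apply: connected_component_sym.
  exact: connected_component_over zz1.
pose A := connected_component (p @^-1` U) (F z1).
have [[hX lpX _] [[cp _] _] Y0O [oX0 _ lX0]] := up.
have oA : open A by exact: unbranched_component_open.
have [g [cg g0 g1 Ag]] : joined R (A `&` p @^-1` Y0) (F z1) x.
  apply: open_connected_joined => //.
  - exact: openI.
  - by apply: lX0 => //; exact: component_connected.
  - split; last by rewrite /= pF.
    apply: connected_component_refl; rewrite /= pF.
    exact: (connected_component_sub zz1).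
have [[hZ _ _] _ Y0Oq _] := uq.
have [|||k [ck k0 qk]] := @path_lift R Z Y q (p \o g) z1
    (unbranched_locally_connected uq) hZ (unbranched_continuous uq).
- by move=> t; exact: (continuous_comp (cg t) (@cp _)).
- by move=> s; apply: Y0Oq; exact: (Ag s).2.
- by rewrite /= g0 pF.
have Fk t : F (k t) = g (clamp t).
  apply: (lift_unique (unbranched_locally_connected up) cp (D := setT) (a := 0)
    (f := F \o k) (g := g \o clamp) hX) => //.
  - exact: real_connectedT.
  - by move=> s _; exact: (continuous_comp (ck s) (@cF _)).
  - by move=> s _; exact: (continuous_comp (@clamp_continuous R s) (cg _)).
  - by move=> s _; rewrite /= pF qk.
  - by move=> s _; rewrite /= pF qk; apply: Y0O; exact: (Ag _).2.
  - by rewrite /= k0 clamp0 g0.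
exists (k 1); last by rewrite Fk clamp1.
apply: (connected_component_trans zz1); rewrite -{1}k0.
apply: (connected_component_image (@real_connectedT R)) => // s _.
split; first exact: ck.
by rewrite /= qk; exact: (connected_component_sub (Ag _).1).
Qed.

(** By [component_lift], the image of a component over [U] contains the whole component of the image
    point, which is open; by [spread_basis] such components suffice. *)
Lemma over_open (G : set Z) : open G -> open (F @` G).
Proof.
move=> oG; apply: open_nbhsP => _ [z Gz <-].
have [U [oU Uz UG]] : exists U, [/\ open U, U (q z)
    & connected_component (q @^-1` U) z `<=` G].
  by apply: spread_basis; [have [_ []] := uq|exact: nbhs_open].
apply: filterS (nbhs_open (unbranched_component_open (F z) up oU) _).
  by move=> x /(component_lift oU)[z' /UG Gz' <-]; exists z'.
by apply: connected_component_refl; rewrite /= pF.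
Qed.

Lemma over_surjective (z : Z) : connected [set: X] -> range F = setT.
Proof.
move=> cX; apply/seteqP; split=> // x _.
have [|z' _ Fz'] := @component_lift setT z x openT; last by exists z'.
by rewrite preimage_setT connected_component_id.
Qed.

End covering_map.

Section universal_property.
Variables (Yt : topologicalType) (pt : Yt -> Y).
Hypotheses (ut : unbranched_over R Y0 pt) (cYt : connected [set: Yt]).
Hypothesis lift_over : forall (X : topologicalType) (p : X -> Y) (z : Yt) (x : X),
  unbranched_over R Y0 p -> Y0 (pt z) -> p x = pt z ->
  exists F : Yt -> X, [/\ continuous F, forall z, p (F z) = pt z & F z = x].

Lemma deck_pt (f : deck pt) (z : Yt) : pt (f z) = pt z.
Proof. exact: (congr1 (fun g => g z) (deck_over f)). Qed.

(** [pt] is lifted through itself in both directions; each composite fixes a point over [Y0], hence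
    is the identity by [over_unique]. *)
Lemma deck_unbranched (z z' : Yt) : Y0 (pt z) -> pt z = pt z' ->
  exists f : deck pt, f z = z'.
Proof.
move=> Yz zz'; have Yz' : Y0 (pt z') by rewrite -zz'.
have [F [cF pF Fz]] := lift_over ut Yz (esym zz').
have [G [cG pG Gz']] := lift_over ut Yz' zz'.
have cFG (f g : Yt -> Yt) : continuous f -> continuous g -> continuous (f \o g).
  exact: continuous_comp_fun.
have id_c : continuous (@id Yt) by move=> ?; exact: cvg_id.
have GF : G \o F = id.
  apply: (over_unique (z := z) ut ut cYt) => //; first exact: cFG.
    by move=> w; rewrite /= pG pF.
  by rewrite /= Fz.
have FG : F \o G = id.
  apply: (over_unique (z := z') ut ut cYt) => //; first exact: cFG.
    by move=> w; rewrite /= pF pG.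
  by rewrite /= Gz'.
have FK : cancel F G by move=> w; rewrite -[LHS]/((G \o F) w) GF.
have GK : cancel G F by move=> w; rewrite -[LHS]/((F \o G) w) FG.
have pFE : pt \o F = pt by apply/funext.
by exists (Deck cF cG FK GK pFE).
Qed.

Lemma deck_component (U : set Y) (f : deck pt) (z z' : Yt) :
  connected_component (pt @^-1` U) z z' ->
  connected_component (pt @^-1` U) (f z) (f z').
Proof.
by apply: connected_component_over => [|w]; [exact: deck_continuous|exact: deck_pt].
Qed.

Lemma deck_transitive (z z' : Yt) : pt z = pt z' -> exists f : deck pt, f z = z'.
Proof.
move=> zz'; have [V V_slsc _] := small_slsc_nbhs (filterT : nbhs (pt z) setT).
have [oV cV Vz _] := V_slsc; have [oY0 _ lY0] := pY0.
have Vz' : V (pt z') by rewrite -zz'.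
have [z1 zz1 Yz1] := component_meets ut oV Vz.
have [z2 zz2 Yz2] := component_meets ut oV Vz'.
(* [z3] lies over [pt z1] in the component of [z'] over [V], so a deck transformation taking [z1] to
   [z3] carries the component of [z] to that of [z']. *)
have /(joined_lift ut)[z3 z23 pz3] : joined R (V `&` Y0) (pt z2) (pt z1).
  apply: open_connected_joined.
  - by case: spaceY.
  - exact: openI.
  - exact: lY0.
  - by split=> //; exact: (connected_component_sub zz2).
  - by split=> //; exact: (connected_component_sub zz1).
have [f fz1] := deck_unbranched Yz1 (esym pz3).
exists f; apply: (component_point_unique spaceY ut V_slsc) => //.
  exact: deck_pt.
apply: (connected_component_trans (deck_component f zz1)); rewrite fz1.
apply: connected_component_sym; exact: connected_component_trans zz2 z23.
Qed.

Section quotient.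
Variables (X : topologicalType) (p : X -> Y) (F : Yt -> X).
Hypotheses (up : unbranched_over R Y0 p).
Hypotheses (cF : continuous F) (pF : forall z, p (F z) = pt z).

(** [component_lift] gives [z2] in the component of [z'] with the same image as [z1]. With
    [f z1 = z2], the maps [F \o f] and [F] agree at [z1], hence everywhere, and the value of [f] at
    [z] is forced by [component_point_unique]. *)
Lemma deck_fibre (z z' : Yt) : F z = F z' ->
  exists f : deck pt, F \o f = F /\ f z = z'.
Proof.
move=> FE; have zz' : pt z = pt z' by rewrite -!pF FE.
have [V V_slsc _] := small_slsc_nbhs (filterT : nbhs (pt z) setT).
have [oV cV Vz _] := V_slsc.
have [z1 zz1 Yz1] := component_meets ut oV Vz.
have := connected_component_over cF pF zz1; rewrite FE.
move=> /(component_lift ut up cF pF oV)[z2 zz2 Fz2].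
have z12 : pt z1 = pt z2 by rewrite -!pF Fz2.
have [f fz1] := deck_unbranched Yz1 z12.
exists f; split.
  apply: (over_unique (z := z1) ut up cYt) => //.
  - by move=> w; exact: (continuous_comp (@deck_continuous _ _ _ f w) (@cF _)).
  - by move=> w; rewrite /= pF deck_pt.
  - by rewrite /= fz1.
apply: (component_point_unique spaceY ut V_slsc) => //; first exact: deck_pt.
apply: (connected_component_trans (deck_component f zz1)); rewrite fz1.
exact: connected_component_sym.
Qed.

End quotient.
End universal_property.
End maps_over.

(** * The universal branched covering *)

Section unbranched_coverings.
Variables (R : realType) (Y : topologicalType).
Hypotheses (spaceY : standing_space R Y) (connY : connected [set: Y]).

Let lcY : locally_connected_space Y.
Proof. by case: spaceY => _ lpY _; exact: lpc_locally_connected lpY. Qed.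

Lemma Ord_base_open (X : topologicalType) (p : X -> Y) : open (Ord_base p).
Proof.
apply: open_nbhsP => y [U [oU Uy homU]].
by apply: filterS (nbhs_open oU Uy) => z Uz; exists U.
Qed.

Lemma homeomorphism_on_open (X : topologicalType) (p : X -> Y) (C : set X)
    (U : set Y) :
  continuous p -> C !=set0 -> p @` C = U ->
  (forall x x', C x -> C x' -> p x = p x' -> x = x') ->
  (forall x G, C x -> nbhs x G -> nbhs (p x) (p @` (G `&` C))) ->
  homeomorphism_on p C U.
Proof.
move=> cp [c Cc] pCU injp openp.
have /choice[g gP] : forall y, exists x, U y -> C x /\ p x = y.
  move=> y; have [|nUy] := pselect (U y); last by exists c.
  by rewrite -pCU => -[x Cx <-]; exists x.
have gpK x : C x -> g (p x) = x.
  move=> Cx; have Upx : U (p x) by rewrite -pCU; exists x.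
  by have [Cg pg] := gP _ Upx; exact: injp.
exists g; split.
- by move=> x Cx; rewrite -pCU; exists x.
- by move=> y /gP[].
- by move=> x /set_mem; exact: gpK.
- by move=> y /set_mem/gP[].
- split; first exact: continuous_subspaceT.
  apply: continuous_in_subspaceT => y /set_mem Uy G /= Gg.
  have [Cg pg] := gP _ Uy.
  have := openp _ _ Cg Gg; rewrite pg; apply: filterS => _ [x [Gx Cx] <-].
  by rewrite /= gpK.
Qed.

(** Portliness is given for the ordinary locus upstairs and for the complement of [S] downstairs;
    local sections of [p] over ordinary points combine the two. *)
Lemma covering_unbranched_over (S : set Y) (X : topologicalType) (p : X -> Y) :
  standing_space R X -> skeletal S -> covering_possibly_branched_over S p ->
  unbranched_over R (~` S) p.
Proof.
move=> sX pY0 [[[sp completep] pT [cX _] pOX _] OS].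
have Y0O : ~` S `<=` Ord_base p by move=> y Sy; apply: contrapT => /OS.
have [hX lpX _] := sX; have [cp _] := sp.
have lcX := lpc_locally_connected lpX.
have [oY0 dY0 lY0] := pY0; have [oOX dOX lOX] := pOX.
have oX0 : open (p @^-1` (~` S)) by move/continuousP: cp; apply.
have dX0 : dense (p @^-1` (~` S)).
  move=> G G0 oG; have [x1 [Gx1 Ox1]] := dOX G G0 oG.
  have [U [oU Ux1 /(_ x1 Ux1)[C [g [oC Cx1 CU sU sC]]]]] := Ord_base_sheet lcX cp Ox1.
  have [_ _ cg] := sU _ Ux1.
  have /nbhs_openP[V [oV Vx1 VUG]] : nbhs (p x1) (U `&` (g @^-1` G)).
    apply: filterI; first exact: nbhs_open.
    by apply: cg; rewrite sC //; exact: nbhs_open.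
  have [|y [/VUG[Uy Gy] Sy]] := dY0 V _ oV; first by exists (p x1).
  by exists (g y); split=> //; have [_ pgy _] := sU _ Uy; rewrite /= pgy.
split=> //; split=> // U0 oU0 cU0.
pose U1 := U0 `&` Ord_total p.
(* Intersecting with [Ord_total p] changes nothing over the complement of [S], keeps the set
   connected, and places each of its points in a sheet. *)
have -> : U0 `&` p @^-1` (~` S) = U1 `&` p @^-1` (~` S).
  by apply/seteqP; split=> [x [Ux Sx]|x [[Ux _] Sx]] //; split=> //; split=> //; exact: Y0O.
apply: locally_connected_in_local => //; [exact: openI|exact: lOX|].
move=> x [U0x Ox].
have [U [oU Ux /(_ x Ux)[C [g [oC Cx CU sU sC]]]]] := Ord_base_sheet lcX cp Ox.
have [_ _ cg] := sU _ Ux.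
have [M [oM Mx MUU cM]] : exists M, [/\ open M, M (p x),
    M `<=` U `&` (g @^-1` U1) & connected M].
  apply: lcY; apply: filterI; first exact: nbhs_open.
  by apply: cg; rewrite sC //; apply: nbhs_open => //; exact: openI.
exists (C `&` p @^-1` M); split.
- by apply: openI => //; move/continuousP: cp; apply.
- by [].
- by move=> x' [Cx' /MUU[_]]; rewrite /= sC.
- have -> : C `&` p @^-1` M `&` p @^-1` (~` S) = g @` (M `&` ~` S).
    apply/seteqP; split=> [x' [[Cx' Mx'] Sx']|_ [y [My Sy] <-]].
      by exists (p x'); [|exact: sC].
    have [Uy _] := MUU _ My; have [Cgy pgy _] := sU _ Uy.
    by split; [split=> //|]; rewrite /= pgy.
  apply: connected_image; first exact: lY0.
  by move=> y [/MUU[Uy _] _]; have [] := sU _ Uy.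
Qed.

(** With the connected space [Y] itself as neighborhood, [component_point] turns a single point
    upstairs into one over every [y]. *)
Lemma unbranched_surjective (Y0 : set Y) (X : topologicalType) (p : X -> Y) (x : X) :
  portly Y0 -> unbranched_over R Y0 p -> range p = setT.
Proof.
move=> pY0 up; apply/seteqP; split=> // y _.
have [x' _ <-] := component_point spaceY pY0 up openT connY (I : setT y) (I : setT (p x)).
by exists x'.
Qed.

Section universal.
Variables (S : set Y) (skelS : skeletal S).
Variables (Yt : topologicalType) (pt : Yt -> Y) (spaceYt : standing_space R Yt).
Variables (W : topologicalType) (c : W -> set_type (~` S)) (i : W -> Yt).
Hypotheses (spaceW : standing_space R W) (univ : universal_covering R c).
Hypothesis compl : is_completion (set_val \o c) pt i.

Let lcYt : locally_connected_space Yt.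
Proof. by case: spaceYt => _ lpYt _; exact: lpc_locally_connected lpYt. Qed.
Let lcW : locally_connected_space W.
Proof. by case: spaceW => _ lpW _; exact: lpc_locally_connected lpW. Qed.
Let cc : continuous c. Proof. by case: univ => -[]. Qed.
Let Oc (u : set_type (~` S)) : Ord_base c u.
Proof. by case: univ => -[_ _ ->]. Qed.
Let spt : spread pt. Proof. by case: compl => _ []. Qed.
Let cpt : continuous pt. Proof. by case: spt. Qed.
Let emb : embedding i. Proof. by case: compl. Qed.
Let ci : continuous i. Proof. exact: embedding_continuous. Qed.
Let pti w : pt (i w) = set_val (c w).
Proof. by case: compl => _ _ _ /(congr1 (fun f => f w)). Qed.
Let oY0 : open (~` S). Proof. by case: skelS. Qed.

Lemma completion_preimage (A : set Yt) : open A -> connected A -> A !=set0 ->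
  connected (i @^-1` A) /\ i @^-1` A !=set0.
Proof.
have [_ _ _ _ [oi di li]] := compl; move=> oA cA A0; split.
  by apply: embedding_preimage_connected => //; exact: li.
by have [x [Ax [w _ ix]]] := di A A0 oA; exists w; rewrite /= ix.
Qed.

Lemma nbhs_set_val (u : set_type (~` S)) (N : set (set_type (~` S))) :
  nbhs u N -> exists O', [/\ open O', O' (set_val u), O' `<=` ~` S &
    forall v : set_type (~` S), O' (set_val v) -> N v].
Proof.
move=> [A [[B oB <-] /= Bu BN]]; exists (B `&` ~` S); split.
- exact: openI.
- by split=> //; exact: set_mem (valP u).
- by move=> y [].
- by move=> v [Bv _]; exact: BN.
Qed.

(** The completion changes nothing over the complement of [S]. A component [C] over an evenly
    covered [U'] meets the image of [W] in one sheet [D], which already fills [C]: the inverse of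
    [c] on that sheet is continuous, so density of the image and the Hausdorff property leave no
    room for further points. *)
Lemma universal_Ord_base (y : Y) : (~` S) y ->
  Ord_base pt y /\ forall z, pt z = y -> range i z.
Proof.
move=> Sy; pose u0 : set_type (~` S) := SigSub (mem_set Sy).
have [U [[B oB BU] Uu0 homU]] := Oc u0.
pose U' := B `&` ~` S.
have oU' : open U' by exact: openI.
have U'U (u : set_type (~` S)) : U' (set_val u) <-> U u.
  rewrite -BU; split=> [[]//|Bu]; split=> //; exact: set_mem (valP u).
have oU : open U by exists B.
have key z : U' (pt z) -> let C := connected_component (pt @^-1` U') z in
    homeomorphism_on pt C U' /\ range i z.
  move=> U'z C.
  have oC : open C.
    by apply: connected_component_open => //; move/continuousP: cpt; apply.
  have Cz : C z by exact: connected_component_refl.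
  have [cD [w Dw]] := completion_preimage oC (@component_connected _ _ _) (ex_intro _ z Cz).
  have U'w : U' (pt (i w)) := connected_component_sub Dw.
  pose D := connected_component (c @^-1` U) w.
  have Uw : (c @^-1` U) w by apply/U'U; rewrite -pti.
  have DE w' : D w' <-> C (i w').
    split=> [ww'|]; last first.
      apply: (connected_component_max Dw) => // v Cv; apply/U'U.
      by rewrite -pti; exact: (connected_component_sub Cv).
    apply: (connected_component_trans Dw).
    apply: (connected_component_image (@component_connected _ (c @^-1` U) w)) => //.
      move=> v wv; split; first exact: ci.
      by rewrite /= pti; apply/U'U; exact: (connected_component_sub wv).
    exact: connected_component_refl.
  have oD : open D.
    by apply: connected_component_open => //; move/continuousP: cc; apply.
  have [|g [cUD gD gc cg [_ ctg]]] := homU D; first by exists w.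
  have locg u A : U u -> nbhs (i (g u)) A -> exists G, [/\ open G, G (set_val u),
      G `<=` ~` S & forall v : set_type (~` S), G (set_val v) -> U v /\ A (i (g v))].
    move=> Uu nA; have cgu := within_open_continuous oU Uu ctg.
    have nN : nbhs u (U `&` ((i \o g) @^-1` A)).
      apply: filterI; first exact: nbhs_open.
      exact: (continuous_comp cgu (@ci _)).
    exact: nbhs_set_val nN.
  (* Let [d = g u] be the point of the sheet [D] over the same base point as [x]. A point of the
     dense image close to [x] has its projection close to [u], so continuity of [g] puts it close to
     [i d]; disjoint neighborhoods of [x] and [i d] forbid this. *)
  have sub x : C x -> exists2 d, D d & i d = x.
    move=> Cx; have [Bx Sx] := connected_component_sub Cx.
    pose u : set_type (~` S) := SigSub (mem_set Sx).
    have Uu : U u by apply/U'U.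
    have Dgu : D (g u) by exact: gD.
    have cgu : c (g u) = u by apply: cg; exact: mem_set.
    exists (g u) => //; apply: contrapT => neq.
    have [hYt _ _] := spaceYt.
    have [A1 [A2 [oA1 oA2 A1d A2x A12]]] := hausdorff_separate hYt neq.
    have [G [oG Gu _ GA]] := locg u _ Uu (nbhs_open oA1 A1d).
    have [_ _ _ _ [_ di _]] := compl.
    have [||x1 [[[Cx1 A2x1] Gx1] [d _ id_x1]]] := di (C `&` A2 `&` pt @^-1` G).
    - by exists x; split=> //; split.
    - by apply: openI; [exact: openI|move/continuousP: cpt; apply].
    subst x1; have Dd : D d by apply/DE.
    move: Gx1; rewrite /= pti => /GA[_]; rewrite gc; last exact: mem_set.
    by move=> /A12; apply.
  split; last by have [d _ <-] := sub z Cz; exists d.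
  apply: homeomorphism_on_open => //; first by exists z.
  - apply/seteqP; split=> [_ [x Cx <-]|y' U'y']; first exact: connected_component_sub Cx.
    pose u : set_type (~` S) := SigSub (mem_set U'y'.2).
    have Uu : U u by apply/U'U.
    exists (i (g u)); first by apply/DE; exact: gD.
    by rewrite pti cg //; exact: mem_set.
  - move=> _ _ /sub[d Dd <-] /sub[d' Dd' <-]; rewrite !pti => /val_inj cdd'.
    by rewrite -(gc d) ?cdd' ?gc //; exact: mem_set.
  - move=> _ A /sub[d Dd <-] nA; rewrite pti.
    have Ucd : U (c d) by exact: (connected_component_sub Dd).
    have [|G [oG Gd GS GA]] := locg (c d) A Ucd.
      by rewrite gc //; exact: mem_set.
    apply: filterS (nbhs_open oG Gd) => y' Gy'.
    pose u : set_type (~` S) := SigSub (mem_set (GS _ Gy')).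
    have [Uu Au] := GA u Gy'.
    exists (i (g u)); first by split=> //; apply/DE; exact: gD.
    by rewrite pti cg //; exact: mem_set.
have U'y : U' y by apply/(U'U u0).
split; last by move=> z zy; have [] := key z; rewrite ?zy.
exists U'; split=> // C [z U'z <-]; exact: (key z U'z).1.
Qed.

Lemma universal_range : range i = pt @^-1` (~` S).
Proof.
apply/seteqP; split=> [_ [w _ <-]|z Sz]; last exact: (universal_Ord_base Sz).2.
by rewrite /= pti; exact: set_mem (valP (c w)).
Qed.

Lemma universal_unbranched : unbranched_over R (~` S) pt.
Proof.
split=> //.
- by have [] := compl.
- by move=> y /universal_Ord_base[].
- by rewrite -universal_range; have [] := compl.
Qed.

Lemma universal_connected : connected [set: Yt].
Proof.
have [_ [pW _]] := univ; have [_ _ _ _ [_ di _]] := compl.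
suff <- : closure (range i) = setT.
  apply/connected_closure/connected_image; last by move=> w _; exact: ci.
  exact: path_connected_connected pW.
apply/seteqP; split=> // x _ N /nbhs_openP[U [oU Ux UN]].
have [|x' [Ux' ix']] := di U _ oU; first by exists x.
by exists x'; split=> //; exact: UN.
Qed.

Lemma universal_surjective : range pt = setT.
Proof.
have [[_ cT _] _] := univ; have [_ dY0 _] := skelS.
apply/seteqP; split=> // y _.
(* A point outside [S] is covered by a point of [W], which makes [Yt] nonempty, as
   [unbranched_surjective] requires. *)
have [|y' [_ Sy']] := dY0 setT _ openT; first by exists y.
have : range c (SigSub (mem_set Sy')) by rewrite cT.
move=> [w _ _].
by rewrite (unbranched_surjective (i w) skelS universal_unbranched).
Qed.

Lemma universal_lift (X : topologicalType) (p : X -> Y) (z : Yt) (x : X) :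
  unbranched_over R (~` S) p -> (~` S) (pt z) -> p x = pt z ->
  exists F : Yt -> X, [/\ continuous F, forall z, p (F z) = pt z & F z = x].
Proof.
move=> up Sz pxz; have [sX csp SO _] := up.
have [hX lpX _] := sX; have [hY _ _] := spaceY; have [_ lpW _] := spaceW.
have lcX := lpc_locally_connected lpX.
have cp : continuous p by have [[]] := csp.
have [w _ wz] : range i z by rewrite universal_range.
have cpti : continuous (pt \o i).
  by move=> v; exact: (continuous_comp (@ci v) (@cpt _)).
have Opti v : Ord_base p ((pt \o i) v).
  by apply: SO; rewrite /= pti; exact: set_mem (valP (c v)).
have [||f [cf pf fw]] := lifting_criterion (w0 := w) (x0 := x) lcX hX cp cpti Opti lpW.
- by case: univ.
- by rewrite /= wz.
have [|F [cF pF Fi]] := extend_over lcYt lcY hX hY cpt csp _ cf pf completion_preimage.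
  rewrite (unbranched_surjective x skelS up) => z'.
  by apply: subset_closure.
by exists F; split=> //; rewrite -wz Fi.
Qed.

End universal.
End unbranched_coverings.

(** * Quotients by groups of deck transformations *)

Section orbits.
Variables (X Y : topologicalType) (p : X -> Y).

Definition mk_subgroup (G : groupType) (S : {pred G}) (S1 : 1%g \in S)
    (SM : mulg_closed S) (SV : invg_closed S) : groupClosed G :=
  GroupClosed.Pack (GroupClosed.Class (isInvClosed.Build G S SV)
    (isMul1Closed.Build G S S1) (isMulClosed.Build G S SM)).

Lemma orbit_pi_eq (H : groupClosed (deck p)) (x y : X) :
  orbit_pi H x = orbit_pi H y <-> exists2 f : deck p, f \in H & f x = y.
Proof.
split; last by move=> Hxy; apply/eqmodP/asboolP.
by move=> /eqmodP/asboolP.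
Qed.

Lemma orbit_pi_repr (H : groupClosed (deck p)) (z : orbit_space H) :
  exists x, orbit_pi H x = z.
Proof. by exists (repr (z : {eq_quot orbit_equiv H}%qT)); exact: reprK. Qed.

Lemma orbit_pi_open (H : groupClosed (deck p)) (G : set (orbit_space H)) :
  open G <-> open (orbit_pi H @^-1` G).
Proof. by []. Qed.

Variables (Z : topologicalType) (q : Z -> Y).

(* Isomorphisms Z -> X/H over Y are the same as open surjections X -> Z over Y
   whose fibres are the H-orbits. *)
Lemma isomorphic_orbit_proj (H : groupClosed (deck p)) (F : X -> Z) :
  continuous F -> (forall G, open G -> open (F @` G)) -> range F = setT ->
  (forall x, q (F x) = p x) ->
  (forall x y, F x = F y <-> exists2 f : deck p, f \in H & f x = y) ->
  isomorphic_over q (orbit_proj H).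
Proof.
move=> cF oF FT qF FE.
have /choice[s sP] : forall z, exists x, F x = z.
  by move=> z; have [x _ <-] : range F z by [rewrite FT]; exists x.
have /choice[t tP] : forall z, exists x, orbit_pi H x = z by exact: orbit_pi_repr.
have piE x y : orbit_pi H x = orbit_pi H y <-> F x = F y.
  by rewrite orbit_pi_eq FE.
have sF x : orbit_pi H (s (F x)) = orbit_pi H x by apply/piE; rewrite sP.
have tF x : F (t (orbit_pi H x)) = F x by apply/piE; rewrite tP.
exists (fun z => orbit_pi H (s z)); last first.
  by apply/funext => z; rewrite /= orbit_projE -qF sP.
exists (fun z => F (t z)); split.
- apply/continuousP => G /orbit_pi_open/oF; congr open.
  apply/seteqP; split=> [_ [x Gx <-]|z Gz]; first by rewrite /= sF.
  by exists (s z); rewrite ?sP.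
- apply/continuousP => G oG; apply/orbit_pi_open.
  have -> : orbit_pi H @^-1` ((fun z => F (t z)) @^-1` G) = F @^-1` G.
    by apply/seteqP; split=> x; rewrite /= tF.
  by move/continuousP: cF; apply.
- by move=> z; rewrite tF sP.
- by move=> z; rewrite -{2}[z]tP -[in LHS](tP z) tF sF.
Qed.

(** This recovers a projection from an abstract isomorphism, so that normality can be discussed for
    every subgroup whose quotient is [Z], and not just for one constructed by hand. *)
Lemma orbit_proj_isomorphic (H : groupClosed (deck p)) :
  isomorphic_over q (orbit_proj H) ->
  exists F : X -> Z, [/\ continuous F, range F = setT,
    forall x, q (F x) = p x
  & forall x y, F x = F y <-> exists2 f : deck p, f \in H & f x = y].
Proof.
move=> [f [g [cf cg fK gK]] qf]; exists (fun x => g (orbit_pi H x)); split.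
- move=> x; apply: continuous_comp; last exact: cg.
  exact: pi_continuous.
- apply/seteqP; split=> // z _; have [x xz] := orbit_pi_repr (f z).
  by exists x; rewrite // xz fK.
- by move=> x; rewrite -qf /= gK orbit_projE.
- move=> x y; rewrite -orbit_pi_eq; split=> [/(congr1 f)|->//].
  by rewrite !gK.
Qed.

End orbits.

Lemma branched_covering_unbranched (R : realType) (Y : topologicalType)
    (Y0 : set Y) (X : topologicalType) (p : X -> Y) :
  connected [set: Y] -> connected [set: X] -> portly Y0 ->
  unbranched_over R Y0 p -> range p = setT -> branched_covering p.
Proof.
move=> cY cX pY0 [_ csp Y0O pX0] pT; have cp : continuous p by case: csp => -[].
split=> //.
- apply: portly_sub pX0 _ _; last by move=> x /Y0O.
  by move/continuousP: cp; apply; exact: Ord_base_open.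
- by apply: portly_sub pY0 _ Y0O; exact: Ord_base_open.
Qed.

(** * Normal subgroups and Galoisian quotients *)

Section normality.
Variables (R : realType) (Y : topologicalType) (Y0 : set Y).
Hypotheses (spaceY : standing_space R Y) (pY0 : portly Y0).
Hypothesis slscY0 : forall y, semi_locally_simply_connected_at R Y0 y.
Variables (Yt : topologicalType) (pt : Yt -> Y).
Hypotheses (ut : unbranched_over R Y0 pt) (cYt : connected [set: Yt]).
Hypothesis trans_pt : forall z z', pt z = pt z' -> exists f : deck pt, f z = z'.
Variables (X : topologicalType) (p : X -> Y) (F : Yt -> X).
Hypothesis up : unbranched_over R Y0 p.
Hypotheses (cF : continuous F) (FT : range F = setT).
Hypothesis pF : forall z, p (F z) = pt z.
Variable H : groupClosed (deck pt).
Hypothesis FE : forall z z', F z = F z' <-> exists2 f : deck pt, f \in H & f z = z'.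

Let Fsurj x : exists z, F z = x.
Proof. by have [z _ <-] : range F x by [rewrite FT]; exists z. Qed.

Lemma orbit_group_invariant (f : deck pt) (z : Yt) : f \in H -> F (f z) = F z.
Proof. by move=> fH; apply/esym/FE; exists f. Qed.

(** The orbit condition gives some [h] in [H] agreeing with [f] at one point over [Y0], and such an
    agreement forces [h = f]. So [H] is the whole group leaving [F] invariant. *)
Lemma invariant_orbit_group (f : deck pt) : F \o f = F -> f \in H.
Proof.
move=> Ff; have [[z]|noz] := pselect (inhabited Yt); last first.
  have -> : f = 1%g by apply/deck_eqP => z; exfalso; exact: noz.
  exact: gpred1.
have [z0 _ Yz0] := component_meets (U := setT) (x := z) ut openT I.
have /FE[h hH hf] : F z0 = F (f z0) by rewrite -[RHS]/((F \o f) z0) Ff.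
suff <- : h = f by [].
apply/deck_eqP => w; suff -> : deck_fun h = deck_fun f by [].
apply: (over_unique (z := z0) ut ut cYt) => //; try exact: deck_continuous.
- by move=> v; exact: deck_pt.
- by move=> v; exact: deck_pt.
Qed.

(** Every [g] descends through [F] to a map [th g]: replacing [z] by [h z] changes [g z] by a
    conjugate of [h], which normality puts in [H]. Continuity of [th g] comes from openness of [F],
    and transitivity on the fibres of [pt] passes to [X]. *)
Lemma normal_transitive : normal_subgroup H ->
  forall x x', p x = p x' -> exists f : deck p, f x = x'.
Proof.
move=> nH; have /choice[s sP] := Fsurj.
pose th (g : deck pt) x := F (g (s x)).
have thF g z : th g (F z) = F (g z).
  have : F (s (F z)) = F z by rewrite sP.
  rewrite /th => /esym/FE[h hH <-].
  rewrite -[RHS](orbit_group_invariant (g z) (nH (g^-1)%g h hH)).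
  by congr F; rewrite /= deck_funK.
have cth g : continuous (th g).
  apply/continuousP => G oG.
  have -> : th g @^-1` G = F @` ((F \o g) @^-1` G).
    apply/seteqP; split=> [x Gx|_ [z Gz <-]]; last by rewrite /= thF.
    by exists (s x); rewrite ?sP.
  apply: (over_open spaceY pY0 slscY0 ut up cF pF).
  have cFg : continuous (F \o g).
    by move=> w; exact: (continuous_comp (@deck_continuous _ _ _ g w) (@cF _)).
  by move/continuousP: cFg; apply.
have thK g : cancel (th g) (th (g^-1)%g).
  by move=> x; have [z <-] := Fsurj x; rewrite !thF /= deck_funK.
have thVK g : cancel (th (g^-1)%g) (th g).
  by move=> x; have [z <-] := Fsurj x; rewrite !thF /= deck_invK.
have pth g : p \o th g = p.
  apply/funext => x; have [z <-] := Fsurj x.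
  by rewrite /= thF !pF deck_pt.
move=> x x' xx'; have [z zx] := Fsurj x; have [z' zx'] := Fsurj x'.
have [|g gz] := trans_pt (z := z) (z' := z'); first by rewrite -!pF zx zx'.
exists (Deck (cth g) (cth (g^-1)%g) (thK g) (thVK g) (pth g)).
by rewrite /= -zx thF gz.
Qed.

(** A deck transformation [psi] of [X] matching [g] at one point over [Y0] satisfies
    [psi \o F = F \o g]. Applying [psi] to [F \o (h ^ g)] gives [F \o h \o g], which is [F \o g],
    that is [psi \o F]; injectivity of [psi] concludes. *)
Lemma transitive_normal :
  (forall x x', p x = p x' -> exists f : deck p, f x = x') -> normal_subgroup H.
Proof.
move=> trans g h hH; apply: invariant_orbit_group; apply/funext => z.
have [z0 _ Yz0] := component_meets (U := setT) (x := z) ut openT I.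
have [|psi psiF] := trans (F z0) (F (g z0)); first by rewrite !pF deck_pt.
have psiE : psi \o F = F \o g.
  apply: (over_unique (z := z0) ut up cYt) => //.
  - by move=> w; exact: (continuous_comp (@cF w) (@deck_continuous _ _ _ psi _)).
  - by move=> w; exact: (continuous_comp (@deck_continuous _ _ _ g w) (@cF _)).
  - by move=> w; rewrite /= deck_pt.
  - by move=> w; rewrite /= pF deck_pt.
apply: (can_inj (@deck_funK _ _ _ psi)).
have psiFE w : psi (F w) = F (g w) by rewrite -[LHS]/((psi \o F) w) psiE.
by rewrite /= !psiFE /= deck_invK orbit_group_invariant.
Qed.

End normality.

Theorem theorem3 (R : realType) (Y : topologicalType) (S : set Y)
  (spaceY : standing_space R Y) (connY : connected [set: Y])
  (skelS : skeletal S)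
  (slscYS : semi_locally_simply_connected R (set_type (~` S)))
  (slscYS_in : semi_locally_simply_connected_in R (~` S))
  (Yt : topologicalType) (pt : Yt -> Y) (spaceYt : standing_space R Yt)
  (univ : universal_covering_possibly_branched_over R S pt) :
  galoisian pt /\
  forall (X : topologicalType) (p : X -> Y),
    standing_space R X -> covering_possibly_branched_over S p ->
    (exists H : groupClosed (deck pt), isomorphic_over p (orbit_proj H)) /\
    (forall H : groupClosed (deck pt), isomorphic_over p (orbit_proj H) ->
       (normal_subgroup H <-> galoisian p)).
Proof.
have [W [c [i [spaceW univW compl]]]] := univ.
have [_ slscY] := slscYS_in.
have ut := universal_unbranched skelS spaceYt spaceW univW compl.
have cYt := universal_connected univW compl.
have lift_pt := universal_lift spaceY connY skelS spaceYt spaceW univW compl.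
have trans_pt := deck_transitive spaceY skelS slscY ut cYt lift_pt.
have ptT := universal_surjective spaceY connY skelS spaceYt spaceW univW compl.
split; first by split=> //; exact: branched_covering_unbranched ut ptT.
move=> X p sX pcov; have up := covering_unbranched_over spaceY sX skelS pcov.
have [[_ pT [cX _] _ _] _] := pcov; split.
  have [F [cF FT pF]] : exists F : Yt -> X,
      [/\ continuous F, range F = setT & forall z, p (F z) = pt z].
    (* If [Yt] is empty, then so is [Y], because [pt] is surjective, and so is [X]; the empty map
       serves. *)
    have [[z]|noz] := pselect (inhabited Yt); last first.
      exists (fun z => False_rect _ (noz (inhabits z))); split.
      - by move=> z; exfalso; exact: noz.
      - apply/seteqP; split=> // x _.
        have : range pt (p x) by rewrite ptT.
        by move=> [z _ _]; exfalso; exact: noz.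
      - by move=> z; exfalso; exact: noz.
    have [z0 _ Sz0] := component_meets (U := setT) (x := z) ut openT I.
    have [x _ xz0] : range p (pt z0) by rewrite pT.
    have [F [cF pF _]] := lift_pt X p z0 x up Sz0 xz0.
    exists F; split=> //.
    exact: (over_surjective spaceY skelS slscY ut up cF pF z).
  pose inv : {pred deck pt} := fun f => `[< F \o f = F >].
  have inv1 : 1%g \in inv by apply/asboolP.
  have invM : mulg_closed inv.
    move=> f g /asboolP Ff /asboolP Fg; apply/asboolP.
    by rewrite [LHS](_ : _ = (F \o f) \o g) // Ff Fg.
  have invV : invg_closed inv.
    move=> f /asboolP Ff; apply/asboolP; rewrite -{1}Ff.
    by apply/funext => z; rewrite /= deck_invK.
  exists (mk_subgroup inv1 invM invV); apply: (isomorphic_orbit_proj (F := F)) => //.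
    by move=> G oG; exact: (over_open spaceY skelS slscY ut up cF pF).
  move=> z z'; split.
    move=> /(deck_fibre spaceY skelS slscY ut cYt lift_pt up cF pF)[f [Ff fz]].
    by exists f => //; apply/asboolP.
  by move=> [f /asboolP Ff <-]; rewrite -[RHS]/((F \o f) z) Ff.
move=> H /orbit_proj_isomorphic[F [cF FT pF FE]]; split.
  move=> nH; split; first by have [] := pcov.
  exact: (normal_transitive spaceY skelS slscY ut trans_pt up cF FT pF FE nH).
by move=> [_ trans]; exact: (transitive_normal ut cYt up cF pF FE trans).
Qed.
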